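(* Let $p$ be a prime, let $\alpha \geq 1$, and let $F = \sum_{n \geq 0} a(n) x^n \in \mathbb{Z}_p[[x]]$ be the Furstenberg series associated with a polynomial $P \in \mathbb{Z}_p[x, y]$ such that $h := \deg_x(P \bmod p) \geq 1$. Let $d = \deg_y(P \bmod p)$, $$N = \tfrac{1}{6} \alpha (\alpha + 1) ((2 h d - 1) \alpha + h d + 1),$$ and $$u = \left\lfloor \log_p \max\!\big(\alpha (\deg_x(P \bmod p^\alpha) - h),\ \alpha (\deg_y(P \bmod p^\alpha) - d) + 1\big) \right\rfloor + 1.$$ Let $Q \in (\mathbb{Z}/p^\alpha\mathbb{Z})[x, y, y^{-1}]$ be a lift of $P/y \bmod p$ which has the same monomial support as $P/y \bmod p$, and let \begin{align*} u_\ell &= \lfloor \log_p \max(p^{\alpha - 1} (d - 1 - \deg \pi_{x, 0}(Q)), 1) \rfloor + 1, \\ u_{\mathrm r} &= \lfloor \log_p \max(p^{\alpha - 1} (d - 1 - \deg \pi_{x, h}(Q)), 1) \rfloor + 1, \\ u_{\mathrm t} &= \lfloor \log_p \max(p^{\alpha - 1} (h - \deg \pi_{y, d - 1}(Q)), 1) \rfloor + 1. \end{align*} Then the minimal $p$-automaton that generates $(a(n) \bmod p^\alpha)_{n \geq 0}$ has size (number of states) at most $$p^N + p^{N - \alpha (\alpha + 1) (h + d - 1) / 2}\, \mathcal{L}(h, d, d) + \max(u_\ell, u_{\mathrm r}, u_{\mathrm t}) + \lfloor \log_p \max(h, d) \rfloor + 2 \alpha - 1 + \tfrac{p^u - 1}{p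 - 1}.$$
   Context: $\mathbb{Z}_p$ denotes the $p$-adic integers. Furstenberg series: let $P \in \mathbb{Z}_p[x, y]$ with $P(0, 0) = 0$ and $\frac{\partial P}{\partial y}(0, 0) \not\equiv 0 \bmod p$. The Furstenberg series associated with $P$ is the unique $F \in \mathbb{Z}_p[[x]]$ satisfying $F(0) = 0$ and $P(x, F) = 0$. (These conditions on $P$ are part of the assumption that $P$ has an associated Furstenberg series; they imply $d \geq 1$.) Automata: a $p$-automaton is a deterministic finite automaton with output and input alphabet $\{0, 1, \dots, p-1\}$; it generates the sequence whose $n$th term is its output when fed the base-$p$ representation of $n$, least significant digit first. The minimal $p$-automaton generating a sequence is the smallest such automaton whose output is not affected by leading $0$s. Its number of states equals the number of elements of the $p$-kernel $\ker_p(b(n)_{n \geq 0}) = \{b(p^e n + r)_{n \geq 0} : e \geq 0,\ 0 \leq r \leq p^e - 1\}$ of the generated sequence. Projections: for a Laurent polynomial $S = \sum_{i, j} c_{i,j} x^i y^j$, put $\pi_{x, i}(S) = \sum_j c_{i,j} y^j$ and $\pi_{y, j}(S) = \sum_i c_{i,j} x^i$. The degree of a nonzero univariate Laurent polynomial is the largest exponent appearing with nonzero coefficient (it may be $-1$). The function $\mathcal{L}$: $\mathcal{L}(l, m, n)$ is the maximum of $\mathrm{lcm}(\mathrm{lcm}(\sigma_1), \mathrm{lcm}(\sigma_2), \mathrm{lcm}(\sigma_3))$ over all integers $1 \leq i \leq l$, $1 \leq j \leq m$, $1 \leq k \leq n$ and all integer partitions $\sigma_1$ of $i$, $\sigma_2$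 of $j$, $\sigma_3$ of $k$, where $\mathrm{lcm}(\sigma)$ is the least common multiple of the parts of $\sigma$. *)

(* Defs.v *)
(* MathComp; [boolp] only supplies extensionality and classical eqType/choiceType. *)
From HB Require Import structures.
From mathcomp Require Import all_boot all_order all_algebra.
From mathcomp Require Import polyXY finmap boolp zify.

Set Implicit Arguments.
Unset Strict Implicit.
Unset Printing Implicit Defensive.

Import Order.TTheory GRing.Theory Num.Theory.
Local Open Scope ring_scope.

(* Z/kZ -> Z/mZ through representatives; the canonical ring morphism when
   1 < m and m divides k. *)
Definition Zp_red (m k : nat) (x : 'Z_k) : 'Z_m := (x : nat)%:R.

Section ZpRed.
Variables m k : nat.
Hypothesis mk : ((Zp_trunc m).+2 %| (Zp_trunc k).+2)%N.

Lemma Zp_redD : {morph @Zp_red m k : x y / x + y}.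
Proof.
move=> x y; apply: val_inj; rewrite /Zp_red -natrD !Zp_nat /=.
by rewrite modn_dvdm.
Qed.

Lemma Zp_redM : {morph @Zp_red m k : x y / x * y}.
Proof.
move=> x y; apply: val_inj; rewrite /Zp_red -natrM !Zp_nat /=.
by rewrite modn_dvdm.
Qed.

Lemma Zp_red0 : @Zp_red m k 0 = 0. Proof. by []. Qed.

Lemma Zp_red1 : @Zp_red m k 1 = 1. Proof. by []. Qed.

Lemma Zp_redN : {morph @Zp_red m k : x / - x}.
Proof.
move=> x; apply: (addrI (Zp_red m x)).
by rewrite -Zp_redD !subrr Zp_red0.
Qed.
End ZpRed.

Lemma Zp_trunc_dvd p n :
  ((Zp_trunc (p ^ n.+1)).+2 %| (Zp_trunc (p ^ n.+2)).+2)%N.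
Proof.
case: p => [|[|p]]; first by rewrite !exp0n.
  by rewrite !exp1n.
have p1 : (1 < p.+2)%N by [].
have lt1 j : (1 < p.+2 ^ j.+1)%N by rewrite -[1%N](exp1n j.+1) ltn_exp2r.
by rewrite !Zp_cast ?lt1 // [(_ ^ n.+2)%N]expnSr dvdn_mulr.
Qed.

(* Z_p as the inverse limit of the Z/p^{n+1}Z, n >= 0. *)
Record padic (p : nat) := Padic {
  padic_res :> forall n, 'Z_(p ^ n.+1);
  padicP : forall n, Zp_red (p ^ n.+1) (padic_res n.+1) = padic_res n }.

Section PadicRing.
Variable p : nat.
Implicit Types x y z : padic p.

Lemma padic_ext x y : (forall n, x n = y n) -> x = y.
Proof.
case: x y => [x hx] [y hy] /= e; have {}e : x = y by apply: functional_extensionality_dep.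
by subst y; congr Padic; apply: Prop_irrelevance.
Qed.

Fact padic0_subproof n : Zp_red (p ^ n.+1) (0 : 'Z_(p ^ n.+2)) = 0.
Proof. exact: Zp_red0. Qed.
Definition padic0 := @Padic p (fun=> 0) padic0_subproof.

Fact padic1_subproof n : Zp_red (p ^ n.+1) (1 : 'Z_(p ^ n.+2)) = 1.
Proof. exact: Zp_red1. Qed.
Definition padic1 := @Padic p (fun=> 1) padic1_subproof.

Fact padicN_subproof x n : Zp_red (p ^ n.+1) (- x n.+1) = - x n.
Proof. by rewrite Zp_redN ?Zp_trunc_dvd // padicP. Qed.
Definition padicN x := Padic (padicN_subproof x).

Fact padicD_subproof x y n :
  Zp_red (p ^ n.+1) (x n.+1 + y n.+1) = x n + y n.
Proof. by rewrite Zp_redD ?Zp_trunc_dvd // !padicP. Qed.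
Definition padicD x y := Padic (padicD_subproof x y).

Fact padicM_subproof x y n :
  Zp_red (p ^ n.+1) (x n.+1 * y n.+1) = x n * y n.
Proof. by rewrite Zp_redM ?Zp_trunc_dvd // !padicP. Qed.
Definition padicM x y := Padic (padicM_subproof x y).

HB.instance Definition _ := gen_eqMixin (padic p).
HB.instance Definition _ := gen_choiceMixin (padic p).

Fact padicDA : associative padicD.
Proof. by move=> x y z; apply: padic_ext => n /=; rewrite addrA. Qed.
Fact padicDC : commutative padicD.
Proof. by move=> x y; apply: padic_ext => n /=; rewrite addrC. Qed.
Fact padic0D : left_id padic0 padicD.
Proof. by move=> x; apply: padic_ext => n /=; rewrite add0r. Qed.
Fact padicND : left_inverse padic0 padicN padicD.
Proof. by move=> x; apply: padic_ext => n /=; rewrite addNr. Qed.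
HB.instance Definition _ :=
  GRing.isZmodule.Build (padic p) padicDA padicDC padic0D padicND.

Fact padicMA : associative padicM.
Proof. by move=> x y z; apply: padic_ext => n /=; rewrite mulrA. Qed.
Fact padicMC : commutative padicM.
Proof. by move=> x y; apply: padic_ext => n /=; rewrite mulrC. Qed.
Fact padic1M : left_id padic1 padicM.
Proof. by move=> x; apply: padic_ext => n /=; rewrite mul1r. Qed.
Fact padicMDl : left_distributive padicM padicD.
Proof. by move=> x y z; apply: padic_ext => n /=; rewrite mulrDl. Qed.
Fact padic1_neq0 : padic1 != 0.
Proof.
by apply/eqP => /(congr1 (fun x : padic p => x 0%N)) /= /eqP; rewrite oner_eq0.
Qed.
HB.instance Definition _ := GRing.Zmodule_isComNzRing.Build (padic p)
  padicMA padicMC padic1M padicMDl padic1_neq0.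
End PadicRing.

(* Reduction Z_p -> Z/p^kZ, for k >= 1 ([Zp_red] only transports along
   k.-1.+1 = k). *)
Definition padic_mod (p k : nat) (x : padic p) : 'Z_(p ^ k) :=
  Zp_red (p ^ k) (x k.-1).

Lemma padic_modS p n (x : padic p) : padic_mod n.+1 x = x n.
Proof. exact: natr_Zp. Qed.

Record fps (R : Type) := Fps { fps_coef :> nat -> R }.

Section FpsRing.
Variable R : comNzRingType.
Implicit Types f g h : fps R.

Lemma fps_ext f g : (forall n, f n = g n) -> f = g.
Proof. by case: f g => [f] [g] /= e; congr Fps; apply/funext. Qed.

Definition fps_of_poly (q : {poly R}) : fps R := Fps (fun n => q`_n).
Definition fps0 := @Fps R (fun=> 0).
Definition fps1 := fps_of_poly 1.
Definition fpsN f := Fps (fun n => - f n).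
Definition fpsD f g := Fps (fun n => f n + g n).
Definition fpsM f g := Fps (fun n => \sum_(i < n.+1) f i * g (n - i)%N).

HB.instance Definition _ := gen_eqMixin (fps R).
HB.instance Definition _ := gen_choiceMixin (fps R).

Fact fpsDA : associative fpsD.
Proof. by move=> x y z; apply: fps_ext => n /=; rewrite addrA. Qed.
Fact fpsDC : commutative fpsD.
Proof. by move=> x y; apply: fps_ext => n /=; rewrite addrC. Qed.
Fact fps0D : left_id fps0 fpsD.
Proof. by move=> x; apply: fps_ext => n /=; rewrite add0r. Qed.
Fact fpsND : left_inverse fps0 fpsN fpsD.
Proof. by move=> x; apply: fps_ext => n /=; rewrite addNr. Qed.
HB.instance Definition _ :=
  GRing.isZmodule.Build (fps R) fpsDA fpsDC fps0D fpsND.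

Definition fps_trunc n f : {poly R} := \poly_(i < n.+1) f i.

Lemma coef_fps_trunc n f i : (i <= n)%N -> (fps_trunc n f)`_i = f i.
Proof. by rewrite coef_poly ltnS => ->. Qed.

Lemma fps_trunc_coefM n f g i : (i <= n)%N ->
  (fps_trunc n f * fps_trunc n g)`_i = fpsM f g i.
Proof.
move=> le_in; rewrite coefM; apply: eq_bigr => -[j /= lt_ji] _.
by rewrite !coef_fps_trunc //; lia.
Qed.

Fact fpsMC : commutative fpsM.
Proof.
by move=> f g; apply: fps_ext => n; rewrite -!(fps_trunc_coefM _ _ (leqnn n)) mulrC.
Qed.
Fact fpsMA : associative fpsM.
Proof.
move=> f g h; apply: fps_ext => n.
transitivity ((fps_trunc n f * (fps_trunc n g * fps_trunc n h))`_n).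
  rewrite coefM; apply: eq_bigr => -[j /= lt_jn] _.
  by rewrite coef_fps_trunc ?fps_trunc_coefM //; lia.
rewrite mulrA coefM; apply: eq_bigr => -[j /= lt_jn] _.
by rewrite coef_fps_trunc ?fps_trunc_coefM //; lia.
Qed.
Fact fps1M : left_id fps1 fpsM.
Proof.
move=> f; apply: fps_ext => n /=.
rewrite big_ord_recl /= coefC eqxx mul1r subn0 big1 ?addr0 // => i _.
by rewrite coefC /= mul0r.
Qed.
Fact fpsMDl : left_distributive fpsM fpsD.
Proof.
move=> f g h; apply: fps_ext => n /=; rewrite -big_split.
by apply: eq_bigr => i _; rewrite mulrDl.
Qed.
Fact fps1_neq0 : fps1 != 0.
Proof.
apply/eqP => /(congr1 (fun x : fps R => x 0%N)) /= /eqP.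
by rewrite coefC eqxx oner_eq0.
Qed.
HB.instance Definition _ := GRing.Zmodule_isComNzRing.Build (fps R)
  fpsMA fpsMC fps1M fpsMDl fps1_neq0.
End FpsRing.

(* A bivariate polynomial in R[x, y] is a {poly {poly R}} whose outer variable
   is y and whose coefficients are polynomials in x, so that the [sizeY] of
   [polyXY], the size in the inner variable, measures the degree in x. *)
Definition degx (R : nzRingType) (P : {poly {poly R}}) : nat := (sizeY P).-1.
Definition degy (R : nzRingType) (P : {poly {poly R}}) : nat := (size P).-1.

Definition poly_mod (p k : nat) (P : {poly {poly (padic p)}}) :
    {poly {poly 'Z_(p ^ k)}} :=
  map_poly (map_poly (@padic_mod p k)) P.

(* The last two conjuncts determine F when the first two hold. *)
Definition furstenberg (p : nat) (P : {poly {poly (padic p)}})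
    (F : fps (padic p)) : Prop :=
  [/\ P.[0].[0] = 0,
      padic_mod 1 P^`().[0].[0] != 0,
      F 0%N = 0
    & (map_poly (@fps_of_poly (padic p)) P).[F] = 0].

(* Laurent polynomials in x and y: (i, j) indexes the monomial x^i y^j. *)
Definition laurent (R : nzRingType) := {fsfun int -> R with 0}.
Definition laurent2 (R : nzRingType) := {fsfun (int * int)%type -> R with 0}.

Section Laurent.
Variable R : nzRingType.

Definition proj_x (i : int) (S : laurent2 R) : laurent R :=
  [fsfun j in [fset m.2 | m in finsupp S]%fset => S (i, j) | 0].

Definition proj_y (j : int) (S : laurent2 R) : laurent R :=
  [fsfun i in [fset m.1 | m in finsupp S]%fset => S (i, j) | 0].

(* 0 by convention on the zero Laurent polynomial. *)
Definition ldeg (S : laurent R) : int :=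
  \big[Num.max/head 0 (finsupp S)]_(j <- finsupp S) j.

Definition div_y (P : {poly {poly R}}) : laurent2 R :=
  [fsfun m in [fset (i%:Z, j%:Z - 1) | i in iota 0 (sizeY P),
                                       j in iota 0 (size P)]%fset
     => P`_(`|m.2 + 1|)`_(`|m.1|) | 0].

Lemma proj_xE i S j : proj_x i S j = S (i, j).
Proof.
rewrite fsfunE; case: ifP => // /negbT h; apply/esym/fsfun_dflt.
by apply: contra h => h; apply/imfsetP; exists (i, j).
Qed.

Lemma proj_yE j S i : proj_y j S i = S (i, j).
Proof.
rewrite fsfunE; case: ifP => // /negbT h; apply/esym/fsfun_dflt.
by apply: contra h => h; apply/imfsetP; exists (i, j).
Qed.

Lemma ldeg_in S : finsupp S != fset0 -> ldeg S \in finsupp S.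
Proof.
case/fset0Pn => j; rewrite /ldeg.
change (j \in enum_fset (finsupp S) ->
  \big[Num.max/head 0 (enum_fset (finsupp S))]_(i <- enum_fset (finsupp S)) i
    \in enum_fset (finsupp S)).
case: (enum_fset _) => //= a s _; rewrite big_seq.
elim/big_ind: _ => [|x y xs ys|//]; first exact: mem_head.
by case: leP.
Qed.

Lemma ldeg_max S j : j \in finsupp S -> j <= ldeg S.
Proof. by move=> Sj; rewrite /ldeg; apply: le_bigmax_seq. Qed.

Lemma div_yE P (i j : nat) : div_y P (i%:Z, j%:Z - 1) = P`_j`_i.
Proof.
rewrite fsfunE /= subrK !absz_nat; case: ifP => // /negbT h.
have [le_j|lt_j] := leqP (size P) j; first by rewrite (nth_default 0 le_j) coef0.
have [le_i|lt_i] := leqP (sizeY P) i.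
  by rewrite (nth_default 0) // (leq_trans (max_size_coefXY _ _)).
case/negP: h; apply/imfset2P; exists i; first by rewrite /= mem_iota.
by exists j => //=; rewrite mem_iota.
Qed.

Lemma div_y0 P (i j : int) : i < 0 \/ j < -1 -> div_y P (i, j) = 0.
Proof.
move=> h; rewrite fsfunE; case: ifP => // /imfset2P[i' _ [j' _ [ei ej]]].
by lia.
Qed.
End Laurent.

(* Q is a lift of S with the same monomials; then Q is in R[x, y, y^-1] if S
   is. *)
Definition same_support_lift (p k : nat) (Q : laurent2 'Z_(p ^ k))
    (S : laurent2 'Z_(p ^ 1)) : Prop :=
  (forall m, Zp_red (p ^ 1) (Q m) = S m) /\ finsupp Q = finsupp S.

Definition is_partition (n : nat) (s : seq nat) : bool :=
  [&& sorted geq s, all (leq 1) s & sumn s == n].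

Definition partitions (n : nat) : seq (seq nat) :=
  [seq s <- [seq map val t | t : n.-bseq 'I_n.+1] | is_partition n s].

Lemma mem_partitions n s : (s \in partitions n) = is_partition n s.
Proof.
rewrite mem_filter andbC; case: (boolP (is_partition n s)); last by rewrite andbF.
case/and3P => _ s1 /eqP sn; rewrite andbT.
have le_sz : (size s <= n)%N.
  rewrite -sn; elim: s s1 {sn} => //= a s IHs /andP[a1 /IHs]; lia.
have lt_s : all (ltn^~ n.+1) s.
  rewrite -sn; elim: s {s1 sn le_sz} => //= a s IHs.
  rewrite ltnS leq_addr /=; apply: sub_all IHs => b /=; lia.
have szt : (size (map (@inord n) s) <= n)%N by rewrite size_map.
apply/imageP; exists (Bseq szt) => //=.
rewrite -map_comp map_id_in // => a /(allP lt_s) /= lt_a.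
by rewrite inordK.
Qed.

Definition lcm_seq (s : seq nat) : nat := \big[lcmn/1%N]_(a <- s) a.

Definition landau3 (l m n : nat) : nat :=
  \max_(1 <= i < l.+1) \max_(1 <= j < m.+1) \max_(1 <= k < n.+1)
    \max_(s1 <- partitions i) \max_(s2 <- partitions j)
      \max_(s3 <- partitions k)
        lcmn (lcmn (lcm_seq s1) (lcm_seq s2)) (lcm_seq s3).

Record dfao (p : nat) (A : Type) := Dfao {
  dfao_state : finType;
  dfao_init : dfao_state;
  dfao_trans : dfao_state -> 'I_p -> dfao_state;
  dfao_out : dfao_state -> A }.

Definition dfao_output (p : nat) (A : Type) (M : dfao p A) (w : seq 'I_p) : A :=
  dfao_out (foldl (@dfao_trans p A M) (dfao_init M) w).

Definition dfao_size (p : nat) (A : Type) (M : dfao p A) : nat :=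
  #|dfao_state M|.

(* w is the base-p representation of n, least significant digit first and
   without leading zeros; 0 is represented by the empty word. *)
Definition base_rep (p n : nat) (w : seq 'I_p) : Prop :=
  foldr (fun (c : 'I_p) m => c + p * m)%N 0%N w = n /\
  (last 1 (map (@nat_of_ord p) w) != 0)%N.

Lemma base_rep_exists p n : (1 < p)%N -> exists w, @base_rep p n w.
Proof.
move=> p1; elim/ltn_ind: n => n IHn.
have [->|n0] := posnP n; first by exists [::].
have [w [wn w0]] := IHn _ (ltn_Pdiv p1 n0).
have lt_r : (n %% p < p)%N by rewrite ltn_mod ltnW.
exists (Ordinal lt_r :: w); split=> /=.
  by rewrite wn mulnC addnC -divn_eq.
case: w wn w0 => //= /esym/eqP; rewrite -leqn0 leqNgt divn_gt0 ?(ltnW p1) //.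
by rewrite -ltnNge => lt_n _; rewrite modn_small // -lt0n.
Qed.

Definition generates (p : nat) (A : Type) (M : dfao p A) (b : nat -> A) : Prop :=
  forall n w, base_rep n w -> dfao_output M w = b n.

(* The most significant digit is read last. *)
Definition ignores_leading_zeros (p : nat) (A : Type) (M : dfao p A) : Prop :=
  forall w (z : 'I_p), z = 0%N :> nat ->
    dfao_output M (rcons w z) = dfao_output M w.

Definition minimal_dfao (p : nat) (A : Type) (M : dfao p A) (b : nat -> A) :
    Prop :=
  [/\ generates M b, ignores_leading_zeros M
    & forall M' : dfao p A, generates M' b -> ignores_leading_zeros M' ->
        (dfao_size M <= dfao_size M')%N].

(* floor (log_p z), for z >= 1. *)
Definition floor_log (p : nat) (z : int) : nat := trunc_log p `|z|%N.

(* For h, d >= 1 the division is exact and the subtraction is not truncated. *)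
Definition expN (alpha h d : nat) : nat :=
  ((alpha * alpha.+1 * ((2 * h * d - 1) * alpha + h * d + 1)) %/ 6)%N.

Lemma expNE alpha h d : (0 < h)%N -> (0 < d)%N ->
  (6 * expN alpha h d =
    alpha * alpha.+1 * ((2 * h * d - 1) * alpha + h * d + 1))%N.
Proof.
move=> h0 d0; rewrite mulnC /expN divnK // -(mulnA 2%N).
have c0 : (0 < h * d)%N by rewrite muln_gt0 h0.
move: (h * d)%N c0 => c c0; case: alpha => // a.
have [q qE] : exists q, (a.+1 * a.+2 * (2 * a.+1 + 1) = 6 * q)%N.
  elim: a => [|a [q qE]]; first by exists 1%N.
  by exists (q + a.+2 * a.+2)%N; nia.
have [r rE] : exists r, (a * a.+1 * a.+2 = 6 * r)%N.
  elim: a {qE} => [|a [r rE]]; first by exists 0%N.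
  have [t tE] : exists t, (a.+1 * a.+2 = 2 * t)%N.
    elim: a {rE} => [|a [t tE]]; first by exists 1%N.
    by exists (t + a.+2)%N; nia.
  by exists (r + t)%N; nia.
have rE' : (6 %| a * a.+1 * a.+2)%N by rewrite rE dvdn_mulr.
rewrite -(dvdn_addl _ rE').
suff -> : (a.+1 * a.+2 * ((2 * c - 1) * a.+1 + c + 1) + a * a.+1 * a.+2 =
           c * (a.+1 * a.+2 * (2 * a.+1 + 1)))%N.
  by rewrite qE dvdn_mull ?dvdn_mulr.
case: c c0 => // c _; have -> : (2 * c.+1 - 1 = 2 * c + 1)%N by lia.
nia.
Qed.

Lemma expN_ge alpha h d : (0 < h)%N -> (0 < d)%N ->
  ((alpha * alpha.+1 * (h + d - 1)) %/ 2 <= expN alpha h d)%N.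
Proof.
move=> h0 d0; rewrite -(leq_pmul2l (isT : 0 < 6)%N) expNE //.
apply: (@leq_trans (3 * (alpha * alpha.+1 * (h + d - 1)))%N).
  by rewrite (_ : 6 = 3 * 2)%N // -mulnA leq_mul2l mulnC leq_divM.
case: alpha => // a; rewrite mulnCA leq_mul2l; apply/orP; right.
case: h h0 => // h _; case: d d0 => // d _.
have -> : (2 * h.+1 * d.+1 - 1 = 2 * (h * d + h + d) + 1)%N by nia.
nia.
Qed.

(* Main.v *)
(* Put R = Z/p^alpha, x = XY and y = Y. Then F is the diagonal of A/G with
   G = P(XY, Y)/Y a unit of R[[X, Y]] and A = Y (dP/dy)(XY, Y) - d P(XY, Y), and
   reading a digit amounts to applying a bivariate Cartier operator. Let Q be the
   part of G supported in the Newton box of P mod p, so that G = Q mod p. Since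
   Q^p = Q(X^p, Y^p) + p E, the quotients
     T_0/Q + p T_1/Q^2 + ... + p^(alpha-1) T_(alpha-1)/Q^alpha,
   with T_k in the (k+1)-fold box, are stable under the Cartier operators, and the
   excess of the degrees of the T_k over the box is divided by p at every step; it
   vanishes after u steps.

   For alpha >= 2, every state after at least u steps is a section of some T_0/Q
   plus p times a quotient as above modulo p^(alpha-1). There are at most p^N of
   these, so that only the tree of the first u levels has to be added. The case
   h = d = 1 needs a little more: only the diagonal of each T_k matters, and for
   alpha = 2 the late states satisfy a common linear recurrence of order one.

   For alpha = 1, a nonzero digit removes the column x^h of the numerator, which
   leaves p^(hd) states. Along the zeros, the columns x^0, x^h and the row y^(d-1)
   of the numerator evolve by univariate Cartier operators attached to the
   corresponding face q of Q. Writing q = z^s g with g(0) <> 0, g divides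
   (z^(p^l - 1) - 1)^(p^e) when l is a multiple of the degrees of the irreducible
   factors of g, which makes the expansion of t/g periodic; hence the faces have
   period l along the zeros. *)

From HB Require Import structures.
Require Import Defs.
From mathcomp Require Import all_boot all_order all_algebra all_field.
From mathcomp Require Import polyXY finmap boolp zify ring.

Set Implicit Arguments.
Unset Strict Implicit.
Unset Printing Implicit Defensive.

Import Order.TTheory GRing.Theory Num.Theory.
Local Open Scope ring_scope.

(** * Power series and Cartier operators *)

Section PowerSeries.
Variable A : comNzRingType.
Implicit Types (f g : fps A) (a : A).

Lemma coef_fpsM f g n : (f * g) n = \sum_(i < n.+1) f i * g (n - i)%N.
Proof. by []. Qed.

Lemma coef_fps1 n : (1 : fps A) n = (n == 0%N)%:R.
Proof. by rewrite /= coefC; case: eqP. Qed.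

Lemma coef_fpsMn f k n : (f *+ k) n = f n *+ k.
Proof. by elim: k => [|k IHk] //; rewrite !mulrS -IHk. Qed.

Lemma coef_fps_sum (I : Type) (r : seq I) (P : pred I) (F : I -> fps A) n :
  (\sum_(i <- r | P i) F i) n = \sum_(i <- r | P i) F i n.
Proof. by elim/big_ind2: _ => // f a g b <- <-. Qed.

Definition fps_mono a k : fps A := Fps (fun n => if n == k then a else 0).

Lemma coef_monoM a k f n :
  (fps_mono a k * f) n = if (k <= n)%N then a * f (n - k)%N else 0.
Proof.
rewrite coef_fpsM; case: leqP => [le_kn|lt_nk].
  rewrite (bigD1 (Ordinal (le_kn : (k < n.+1)%N))) //= eqxx big1 ?addr0 // => i.
  by rewrite -val_eqE /= => /negPf ->; rewrite mul0r.
rewrite big1 // => i _ /=; case: eqP => [e|_]; last by rewrite mul0r.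
by have := ltn_ord i; rewrite e ltnS leqNgt lt_nk.
Qed.

Lemma fps_monoM a b k l : fps_mono a k * fps_mono b l = fps_mono (a * b) (k + l)%N.
Proof.
apply: fps_ext => n; rewrite coef_monoM /=.
case: leqP => [le_kn|lt_nk]; last by case: eqP => // e; lia.
by rewrite -[in RHS](subnKC le_kn) eqn_add2l; case: eqP => // _; rewrite mulr0.
Qed.

Lemma fps_mono_exp a k n : fps_mono a k ^+ n = fps_mono (a ^+ n) (k * n)%N.
Proof.
elim: n => [|n IHn]; last by rewrite !exprS IHn fps_monoM mulnS.
by apply: fps_ext => n; rewrite !expr0 muln0 coef_fps1 /=; case: eqP.
Qed.

Lemma coef_fps_exp_congr f g n k : (forall i, (i <= n)%N -> f i = g i) ->
  forall i, (i <= n)%N -> (f ^+ k) i = (g ^+ k) i.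
Proof.
move=> efg; elim: k => [|k IHk] i le_in; first by rewrite !expr0.
rewrite !exprS !coef_fpsM; apply: eq_bigr => -[j /= lt_ji] _.
by rewrite efg ?IHk //; lia.
Qed.

Lemma fps_inv_exists f a : f 0%N * a = 1 -> exists g, f * g = 1.
Proof.
move=> fa.
(* [step s] solves for the next coefficient of the inverse, by requiring the coefficient of index
   [size s] in the product to vanish; [l n] collects the first [n.+1] coefficients. *)
pose step (s : seq A) := - a * \sum_(i < size s) f i.+1 * s`_(size s - i.+1).
pose l n := iter n (fun s => rcons s (step s)) [:: a].
have size_l n : size (l n) = n.+1 by elim: n => //= n; rewrite size_rcons => ->.
have nth_l n m i : (i <= n <= m)%N -> (l m)`_i = (l n)`_i.
  move=> /andP[le_in]; elim: m => [|m IHm].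
    by rewrite leqn0 => /eqP ->.
  rewrite leq_eqVlt => /orP[/eqP -> //|]; rewrite ltnS => le_nm.
  by rewrite /= nth_rcons size_l ltnS (leq_trans le_in le_nm) IHm.
pose g : fps A := Fps (fun n => (l n)`_n).
exists g; apply: fps_ext => -[|n].
  by rewrite coef_fpsM big_ord_recl big_ord0 coef_fps1 addr0 /= fa.
rewrite coef_fpsM coef_fps1 big_ord_recl /= subn0 nth_rcons size_l ltnn eqxx.
rewrite /step size_l mulrA mulrN fa mulN1r addrC; apply/eqP; rewrite subr_eq0.
apply/eqP/eq_bigr => -[i /= lt_in] _; rewrite /bump /= add1n subSS.
by congr (_ * _); apply/esym/nth_l; lia.
Qed.

(* [s] plays the role of a section operator on the coefficients, [phi] that of a
   lift of Frobenius: for [s = phi = id] these are the Cartier operators and the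
   substitution of x^p, and iterating once more gives the bivariate versions. *)
Section Cartier.
Variable p : nat.

Lemma sum_dvdn (V : zmodType) n (F : nat -> V) :
  (forall i, ~~ (p %| i)%N -> F i = 0) ->
  \sum_(i < n.+1) F i = \sum_(i < (n %/ p).+1) F (p * i)%N.
Proof.
have [p0|p_gt0] := posnP p.
  move=> F0; rewrite p0 divn0 big_ord1 big_ord_recl big1 ?addr0 // => i _.
  by rewrite F0 // p0.
move=> F0; elim: n => [|n IHn]; first by rewrite div0n !big_ord1 muln0.
rewrite big_ord_recr IHn /=; have [dvd_p|ndvd_p] := boolP (p %| n.+1)%N.
  have e : (n.+1 %/ p)%N = (n %/ p).+1 by rewrite divnS // dvd_p.
  rewrite e [RHS]big_ord_recr; congr (_ + F _).
  by rewrite /= -e mulnC divnK.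
by rewrite F0 // addr0 divnS // (negPf ndvd_p).
Qed.

Definition fps_frob (phi : A -> A) f : fps A :=
  Fps (fun n => if (p %| n)%N then phi (f (n %/ p)%N) else 0).

Lemma coef_fps_frob phi f n : (0 < p)%N -> fps_frob phi f (p * n)%N = phi (f n).
Proof. by move=> p_gt0; rewrite /= dvdn_mulr // mulKn. Qed.

Definition fps_sect (s : A -> A) r f : fps A := Fps (fun n => s (f (p * n + r)%N)).

(** Projection formula: the twisted factor only has exponents divisible by [p], so it respects the
    classes of exponents modulo [p], and the hypothesis on [s] undoes [phi] on its coefficients. *)
Lemma fps_sect_frob (s phi : A -> A) r f g : (r < p)%N ->
  {morph s : x y / x + y} -> (forall a b, s (a * phi b) = s a * b) ->
  fps_sect s r (f * fps_frob phi g) = fps_sect s r f * g.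
Proof.
move=> lt_rp sD sM; have p_gt0 : (0 < p)%N by case: (p) lt_rp.
apply: fps_ext => n.
have s0 : s 0 = 0 by apply: (addrI (s 0)); rewrite -sD !addr0.
rewrite -[LHS]/(s ((f * fps_frob phi g) (p * n + r)%N)) [f * _]mulrC.
rewrite [fps_sect _ _ _ * _]mulrC !coef_fpsM.
have -> (m : nat) (F : 'I_m -> A) : s (\sum_(i < m) F i) = \sum_(i < m) s (F i).
  by apply: (big_morph s sD s0).
rewrite (@sum_dvdn _ _ (fun i => s (fps_frob phi g i * f (p * n + r - i)%N))).
  rewrite mulnC divnMDl // divn_small // addn0; apply: eq_bigr => -[i /= le_in] _.
  rewrite dvdn_mulr // mulKn // mulrC sM mulrC.
  by congr (g i * s (f _)); rewrite mulnBr mulnC; nia.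
by move=> i /= /negPf ->; rewrite mul0r s0.
Qed.

Section Morphism.
Variable phi : {rmorphism A -> A}.

Fact fps_frob_zmod : zmod_morphism (fps_frob phi).
Proof.
move=> f g; apply: fps_ext => n /=; case: ifP => _; last by rewrite oppr0 addr0.
by rewrite rmorphB.
Qed.

Fact fps_frob_monoid : monoid_morphism (fps_frob phi).
Proof.
(* For [p = 0] only the constant term survives; treating this case lets the morphism instance hold
   for every [p]. *)
have [p0|p_gt0] := posnP p.
  have e f n : fps_frob phi f n = if n == 0%N then phi (f 0%N) else 0.
    by rewrite /= p0 dvd0n; case: eqP => // ->; rewrite divn0.
  split=> [|f g]; apply: fps_ext => n; rewrite e.
    by rewrite !coef_fps1 rmorph1; case: eqP.
  have -> : fps_frob phi f = fps_mono (phi (f 0%N)) 0.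
    by apply: fps_ext => i; rewrite e.
  by rewrite coef_monoM subn0 e coef_fpsM big_ord1 rmorphM; case: eqP; rewrite ?mulr0.
split=> [|f g]; apply: fps_ext => n.
  rewrite coef_fps1 /=; case: ifP => [/dvdnP[m ->]|]; last by case: n => //; rewrite dvdn0.
  rewrite mulnK // coefC muln_eq0 (gtn_eqF p_gt0) orbF.
  by case: (m == 0%N); rewrite ?rmorph1 ?rmorph0.
rewrite [LHS]/= coef_fpsM.
rewrite (@sum_dvdn _ _ (fun i => fps_frob phi f i * fps_frob phi g (n - i)%N)).
  case: ifP => [/dvdnP[m ->]|/negP ndvd_p].
    rewrite mulnK // rmorph_sum; apply: eq_bigr => i _.
    by rewrite coef_fps_frob // [(m * p)%N]mulnC -mulnBr coef_fps_frob // rmorphM.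
  rewrite big1 // => i _.
  have le_in : (p * i <= n)%N by rewrite mulnC -leq_divRL // -ltnS.
  rewrite [fps_frob _ g _]/= ifN ?mulr0 //; apply: contra_notN ndvd_p.
  by rewrite dvdn_subl ?dvdn_mulr.
by move=> i /= /negPf ->; rewrite mul0r.
Qed.

HB.instance Definition _ :=
  GRing.isZmodMorphism.Build (fps A) (fps A) (fps_frob phi) fps_frob_zmod.
HB.instance Definition _ :=
  GRing.isMonoidMorphism.Build (fps A) (fps A) (fps_frob phi) fps_frob_monoid.
End Morphism.
End Cartier.
End PowerSeries.

(** For [phi = idfun] on Z/p^n this is Fermat's little theorem; for [fps_frob] it says that f^p
    agrees modulo [p] with f after x is replaced by x^p. *)
Definition frob_lift (p : nat) (A : comNzRingType) (phi : A -> A) : Prop :=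
  forall a, exists e, a ^+ p = phi a + e *+ p.

Lemma exprD_prime (A : comNzRingType) p (a b : A) : prime p ->
  exists c, (a + b) ^+ p = a ^+ p + b ^+ p + c *+ p.
Proof.
move=> p_prime; have p_gt0 := prime_gt0 p_prime.
exists (\sum_(i < p.-1) a ^+ (p - i.+1) * b ^+ i.+1 *+ ('C(p, i.+1) %/ p)).
rewrite exprDn -(prednK p_gt0) big_ord_recl big_ord_recr /= prednK //.
rewrite /bump /= add1n prednK // bin0 binn subnn subn0 !expr0 mulr1 mul1r !mulr1n.
rewrite [X in _ + X]addrC addrA; congr (_ + _).
rewrite -sumrMnl; apply: eq_bigr => -[i /= lt_i] _.
rewrite add1n -mulrnA divnK // prime_dvd_bin //; lia.
Qed.

(** Truncations are handled by adding one monomial at a time with [exprD_prime]. The general case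
    follows coefficientwise, since the coefficient of x^n in f^p only sees f up to degree n. *)
Lemma fps_frob_lift (A : comNzRingType) p (phi : {rmorphism A -> A}) :
  prime p -> frob_lift p phi -> frob_lift p (fps_frob p phi).
Proof.
move=> p_prime phiP f; have p_gt0 := prime_gt0 p_prime.
pose tr n : fps A := Fps (fun i => if (i < n)%N then f i else 0).
have trP n : exists e, tr n ^+ p = fps_frob p phi (tr n) + e *+ p.
  elim: n => [|n [e IHn]].
    have -> : tr 0%N = 0 by apply: fps_ext.
    by exists 0; rewrite expr0n gtn_eqF // mul0rn addr0 (rmorph0 (fps_frob p phi)).
  have -> : tr n.+1 = tr n + fps_mono (f n) n.
    apply: fps_ext => i /=; rewrite ltnS leq_eqVlt.
    by case: (eqVneq i n) => [->|_]; rewrite ?ltnn ?add0r ?addr0.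
  have [c ->] := exprD_prime (tr n) (fps_mono (f n) n) p_prime.
  have [e' phie] := phiP (f n).
  exists (e + fps_mono e' (n * p) + c).
  rewrite IHn fps_mono_exp phie rmorphD !mulrnDl.
  have -> : fps_mono (phi (f n) + e' *+ p) (n * p)%N =
      fps_frob p phi (fps_mono (f n) n) + fps_mono e' (n * p)%N *+ p.
    apply: fps_ext => i; rewrite [RHS]/= coef_fpsMn /=.
    have [->|ne_i] := eqVneq i (n * p)%N; first by rewrite dvdn_mull // mulnK ?eqxx.
    rewrite mul0rn addr0; case: ifP => // /dvdnP[j e_i].
    rewrite e_i mulnK // ifN ?rmorph0 //.
    by apply: contra ne_i => /eqP e_j; rewrite e_i e_j.
  ring.
(* The quotients obtained from different truncations need not agree, so each is used for a single
   coefficient only. *)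
have /choice[e eP] n : exists e, (f ^+ p) n = fps_frob p phi f n + e *+ p.
  have [e /(congr1 (fun g : fps A => g n))] := trP n.+1.
  rewrite (coef_fps_exp_congr p (g := f) (n := n)) //; last first.
    by move=> i le_in /=; rewrite ltnS le_in.
  move=> ->; exists (e n); rewrite [LHS]/= coef_fpsMn /=.
  by rewrite ltnS leq_div.
by exists (Fps e); apply: fps_ext => n; rewrite [RHS]/= coef_fpsMn.
Qed.

(** * Bivariate power series *)

Section Bivariate.
Variable R : comNzRingType.
Implicit Types (f g T : fps (fps R)) (S : nat -> nat -> Prop).

Lemma bfps_ext f g : (forall i j, f j i = g j i) -> f = g.
Proof. by move=> e; apply: fps_ext => j; apply: fps_ext => i. Qed.

Lemma coef_bfpsMn f k i j : (f *+ k) j i = f j i *+ k.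
Proof. by rewrite !coef_fpsMn. Qed.

Lemma coef_bfpsM f g i j : (f * g) j i =
  \sum_(l < j.+1) \sum_(k < i.+1) f l k * g (j - l)%N (i - k)%N.
Proof. by rewrite coef_fpsM coef_fps_sum. Qed.

(** The outer variable is Y and the inner one X: [f j i] is the coefficient of X^i Y^j, whereas [S]
    takes the exponent of X first. *)
Definition supp2 S f := forall i j, f j i != 0 -> S i j.

Lemma supp2_sub S S' f : (forall i j, S i j -> S' i j) -> supp2 S f -> supp2 S' f.
Proof. by move=> SS' Sf i j /Sf /SS'. Qed.

Lemma supp2_0 S : supp2 S 0.
Proof. by move=> i j; rewrite eqxx. Qed.

Lemma supp2_1 S : S 0%N 0%N -> supp2 S 1.
Proof.
move=> S0 i j; rewrite coef_fps1; case: j => [|j]; last by rewrite eqxx.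
by rewrite coef_fps1; case: i => [|i] //; rewrite eqxx.
Qed.

Lemma supp2D S f g : supp2 S f -> supp2 S g -> supp2 S (f + g).
Proof.
move=> Sf Sg i j; rewrite -[(f + g) j i]/(f j i + g j i) => fg0.
have [f0|/Sf //] := eqVneq (f j i) 0; apply: Sg.
by apply: contra fg0 => /eqP g0; rewrite f0 g0 addr0.
Qed.

Lemma supp2N S f : supp2 S f -> supp2 S (- f).
Proof. by move=> Sf i j; rewrite -[(- f) j i]/(- f j i) oppr_eq0 => /Sf. Qed.

Lemma supp2B S f g : supp2 S f -> supp2 S g -> supp2 S (f - g).
Proof. by move=> Sf /supp2N; apply: supp2D. Qed.

Lemma supp2Mn S f k : supp2 S f -> supp2 S (f *+ k).
Proof.
move=> Sf i j; rewrite coef_bfpsMn => f0; apply: Sf.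
by apply: contra f0 => /eqP ->; rewrite mul0rn.
Qed.

Lemma supp2M S1 S2 S f g :
  (forall i j k l, S1 i j -> S2 k l -> S (i + k)%N (j + l)%N) ->
  supp2 S1 f -> supp2 S2 g -> supp2 S (f * g).
Proof.
move=> SD Sf Sg i j; rewrite coef_bfpsM => fg0.
suff [l [k [lj ki fg]]] : exists l k, [/\ (l <= j)%N, (k <= i)%N &
    f l k * g (j - l)%N (i - k)%N != 0].
  rewrite -(subnKC lj) -(subnKC ki); apply: SD.
    by apply: Sf; apply: contra fg => /eqP ->; rewrite mul0r.
  by apply: Sg; apply: contra fg => /eqP ->; rewrite mulr0.
apply: contrapT => /forallNP nlk; move/eqP: fg0; apply.
rewrite big1 // => -[l /= lj] _; rewrite big1 // => -[k /= ki] _.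
have /forallNP/(_ k) nk := nlk l.
by apply/eqP; apply: contrapT => /negP fg; apply: nk; split.
Qed.

(** Induction on i + j: the vanishing coefficient of the product expresses [g j i] through products
    of a coefficient of f and an earlier one of g, whose exponents stay in the submonoid [S]. *)
Lemma supp2_inv S f g a :
  S 0%N 0%N -> (forall i j k l, S i j -> S k l -> S (i + k)%N (j + l)%N) ->
  supp2 S f -> f 0%N 0%N * a = 1 -> f * g = 1 -> supp2 S g.
Proof.
move=> S0 SD Sf fa fg i j; move: {2}(i + j)%N (leqnn (i + j)) => n.
elim: n i j => [|n IHn] i j le_n gij.
  by have [-> ->] : i = 0%N /\ j = 0%N by lia.
apply: contrapT => nS; move/eqP: gij; apply.
have ij0 : (1 : fps (fps R)) j i = 0.
  by apply/eqP; apply: contrapT => /negP /(supp2_1 S0).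
rewrite -[LHS]mul1r -fa mulrAC; suff -> : f 0%N 0%N * g j i = 0.
  by rewrite mul0r.
rewrite -[RHS]ij0 -fg coef_bfpsM big_ord_recl big_ord_recl !subn0 -addrA.
rewrite [X in _ + X](_ : _ = 0) ?addr0 // addrC.
suff F0 l k : (l <= j)%N -> (k <= i)%N -> (0 < l + k)%N ->
    f l k * g (j - l)%N (i - k)%N = 0.
  rewrite !big1 ?addr0 // => [[l lj]|[k ki]] _; last first.
    by rewrite big1 // => -[k' ki'] _; rewrite F0 //= /bump; lia.
  by rewrite -[in g j](subn0 j) F0 //= /bump; lia.
move=> lj ki lk0; apply/eqP; apply: contrapT => /negP fg0; apply: nS.
rewrite -(subnKC lj) -(subnKC ki); apply: SD.
  by apply: Sf; apply: contra fg0 => /eqP ->; rewrite mul0r.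
apply: IHn; first by lia.
by apply: contra fg0 => /eqP ->; rewrite mulr0.
Qed.

Definition restrict2 (b : nat -> nat -> bool) f : fps (fps R) :=
  Fps (fun j => Fps (fun i => if b i j then f j i else 0)).

Lemma supp2_restrict (b : nat -> nat -> bool) f : supp2 b (restrict2 b f).
Proof. by move=> i j /=; case: ifP => //; rewrite eqxx. Qed.

Lemma restrict2_id (b : nat -> nat -> bool) f : supp2 b f -> restrict2 b f = f.
Proof.
move=> Sf; apply: bfps_ext => i j /=; case: ifP => // /negbT nb.
by apply/esym/eqP; apply: contraNT nb; apply: Sf.
Qed.

(** As [k] may be a zero divisor, a quotient by [k] can have a larger support than f; it is cut
    down. *)
Lemma supp2_divMn (b : nat -> nat -> bool) f g k :
  supp2 b f -> f = g *+ k -> f = restrict2 b g *+ k.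
Proof.
move=> Sf fE; rewrite -[LHS](restrict2_id Sf) fE; apply: bfps_ext => i j.
by rewrite coef_bfpsMn /= coef_bfpsMn; case: ifP; rewrite ?mul0rn.
Qed.

Lemma bfps_inv_exists f a : f 0%N 0%N * a = 1 -> exists g, f * g = 1.
Proof. by case/fps_inv_exists => b; apply: fps_inv_exists. Qed.

Definition diag f : fps R := Fps (fun n => f n n).

Lemma diagD f g : diag (f + g) = diag f + diag g.
Proof. exact: fps_ext. Qed.

Lemma diagMn f k : diag (f *+ k) = diag f *+ k.
Proof. by apply: fps_ext => n; rewrite coef_fpsMn /= coef_bfpsMn. Qed.

Lemma diag_supp0 S f : (forall i, ~ S i i) -> supp2 S f -> diag f = 0.
Proof.
by move=> nS Sf; apply: fps_ext => n /=; apply: contrapT => /eqP /Sf /nS.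
Qed.

Section Sections.
Variable p : nat.

Definition sect1 r (f : fps R) : fps R := fps_sect p id r f.

Definition sect2 r f : fps (fps R) := fps_sect p (sect1 r) r f.

Definition frob2 : fps (fps R) -> fps (fps R) := fps_frob p (fps_frob p idfun).

Lemma sect1D r : {morph sect1 r : f g / f + g}.
Proof. by move=> f g; apply: fps_ext. Qed.

Lemma sect1Mn r k : {morph sect1 r : f / f *+ k}.
Proof. by move=> f; apply: fps_ext => n; rewrite /= !coef_fpsMn. Qed.

Lemma sect2D r : {morph sect2 r : f g / f + g}.
Proof. by move=> f g; apply: bfps_ext. Qed.

Lemma sect2Mn r k : {morph sect2 r : f / f *+ k}.
Proof. by move=> f; apply: bfps_ext => i j; rewrite coef_bfpsMn /= coef_bfpsMn. Qed.

Lemma sect2B r : {morph sect2 r : f g / f - g}.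
Proof. by move=> f g; apply: bfps_ext. Qed.

Lemma diag_sect2 r f : diag (sect2 r f) = sect1 r (diag f).
Proof. exact: fps_ext. Qed.

Lemma sect1_frob r (f g : fps R) : (r < p)%N ->
  sect1 r (f * fps_frob p idfun g) = sect1 r f * g.
Proof. by move=> lt_rp; apply: fps_sect_frob. Qed.

Lemma sect2_frob r f g : (r < p)%N -> sect2 r (f * frob2 g) = sect2 r f * g.
Proof.
by move=> lt_rp; apply: fps_sect_frob => // a b; apply: sect1_frob.
Qed.

Lemma supp2_frob S S' f : (forall i j, S i j -> S' (p * i)%N (p * j)%N) ->
  supp2 S f -> supp2 S' (frob2 f).
Proof.
move=> SS' Sf i j /=; case: ifP => [/dvdnP[l ->]|_]; last by rewrite eqxx.
rewrite /=; case: ifP => [/dvdnP[k ->]|_]; last by rewrite eqxx.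
have [p0|p_gt0] := posnP p.
  by rewrite p0 !muln0 div0n => /Sf /SS'; rewrite p0.
by rewrite !mulnK // => /Sf /SS'; rewrite ![(p * _)%N]mulnC.
Qed.
End Sections.

(* [i <= A], [i - j <= B] and [j - i <= C]: in terms of [x = XY] and [y = Y],
   the exponent of x is at most [A] and that of y lies between [-B] and [C]. *)
Definition box (A B C i j : nat) : bool :=
  [&& (i <= A)%N, (i <= j + B)%N & (j <= i + C)%N].

Lemma box_le A B C A' B' C' f :
  (A <= A')%N -> (B <= B')%N -> (C <= C')%N ->
  supp2 (box A B C) f -> supp2 (box A' B' C') f.
Proof. by move=> AA BB CC; apply: supp2_sub => i j; rewrite /box; lia. Qed.

Lemma boxM A B C A' B' C' f g : supp2 (box A B C) f -> supp2 (box A' B' C') g ->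
  supp2 (box (A + A') (B + B') (C + C')) (f * g).
Proof. by apply: supp2M => i j k l; rewrite /box; lia. Qed.

Lemma box_exp A B C f n : supp2 (box A B C) f ->
  supp2 (box (n * A) (n * B) (n * C)) (f ^+ n).
Proof.
move=> fb; elim: n => [|n IHn]; first by rewrite expr0; apply: supp2_1.
by rewrite exprS !mulSn; apply: boxM.
Qed.

Lemma box_sect2 p r A B C f : (0 < p)%N -> supp2 (box A B C) f ->
  supp2 (box (A %/ p) (B %/ p) (C %/ p)) (sect2 p r f).
Proof.
move=> p_gt0 fb i j /= /fb /and3P[iA iB jC]; apply/and3P; split.
- by rewrite leq_divRL //; lia.
- by rewrite -leq_subLR leq_divRL // mulnBl; lia.
- by rewrite -leq_subLR leq_divRL // mulnBl; lia.
Qed.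
End Bivariate.

(** * Quotients by powers of Q and Cartier operators *)

Section Levels.
Variables (R : comNzRingType) (p h D : nat) (Q U : fps (fps R)).
Hypothesis Q_box : supp2 (box h 1 D) Q.
Hypothesis QU : Q * U = 1.
Implicit Types (f g T : fps (fps R)).

(* Numerators over [Q ^+ m.+1], with excess [ex] in x and [ey] in y. *)
Definition tbox ex ey m := box (m.+1 * h + ex) m (m.+1 * D + ey).

(* [f = T_0 / Q^(m+1) + p T_1 / Q^(m+2) + ... + p^(a-1) T_(a-1) / Q^(m+a)]
   modulo [p^a]. *)
Fixpoint level ex ey a m f : Prop :=
  if a is a'.+1 then
    exists T g, [/\ supp2 (tbox ex ey m) T, level ex ey a' m.+1 g
                  & f = T * U ^+ m.+1 + g *+ p]
  else True.

Lemma level_le ex ey ex' ey' a m f : (ex <= ex')%N -> (ey <= ey')%N ->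
  level ex ey a m f -> level ex' ey' a m f.
Proof.
move=> le_x le_y; elim: a m f => //= a IHa m f [T [g [Tb gl ->]]].
exists T, g; split=> //; last exact: IHa.
by apply: box_le Tb; rewrite ?leq_add2l.
Qed.

Lemma levelD ex ey a m f f' :
  level ex ey a m f -> level ex ey a m f' -> level ex ey a m (f + f').
Proof.
elim: a m f f' => //= a IHa m f f' [T [g [Tb gl ->]]] [T' [g' [Tb' gl' ->]]].
exists (T + T'), (g + g'); split; [exact: supp2D|exact: IHa|].
by rewrite mulrDl mulrnDl addrACA.
Qed.

Lemma levelN ex ey a m f : level ex ey a m f -> level ex ey a m (- f).
Proof.
elim: a m f => //= a IHa m f [T [g [Tb gl ->]]].
exists (- T), (- g); split; [exact: supp2N|exact: IHa|].
by rewrite opprD mulNr mulNrn.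
Qed.

(** Each fraction is expanded by [Q], whose box is exactly the growth of [tbox] from [m] to
    [m.+1]. *)
Lemma levelS ex ey a m f : level ex ey a m f -> level ex ey a m.+1 f.
Proof.
elim: a m f => //= a IHa m f [T [g [Tb gl ->]]].
exists (T * Q), g; split; last first.
- by rewrite [U ^+ m.+2]exprS mulrA -[T * Q * U]mulrA QU mulr1.
- exact: IHa.
by apply: box_le (boxM Tb Q_box); rewrite ?mulSn; lia.
Qed.

Lemma level_le_den ex ey a m n f : (m <= n)%N ->
  level ex ey a m f -> level ex ey a n f.
Proof. by move=> /subnK <-; elim: (n - m)%N => //= k IHk /IHk /levelS. Qed.

Lemma level0 ex ey a m : level ex ey a m 0.
Proof.
elim: a m => //= a IHa m; exists 0, 0; split=> //; first exact: supp2_0.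
by rewrite mul0r mul0rn addr0.
Qed.

Lemma level_mulp ex ey a m f : level ex ey a m.+1 f -> level ex ey a.+1 m (f *+ p).
Proof.
by move=> fl; exists 0, f; split; rewrite ?mul0r ?add0r //; apply: supp2_0.
Qed.

Lemma level_num ex ey a m T : supp2 (tbox ex ey m) T ->
  level ex ey a m (T * U ^+ m.+1).
Proof.
case: a => //= a Tb; exists T, 0; split=> //; first exact: level0.
by rewrite mul0rn addr0.
Qed.

Hypothesis p_prime : prime p.
Hypothesis R_lift : frob_lift p (@idfun R).

(** Write Q^p as its Frobenius twist plus p E and multiply by the inverses of both powers. [E] is
    cut down to the box of Q^p. *)
Lemma frob_inverse : exists2 E, supp2 (box (p * h) p (p * D)) E &
  U ^+ p = frob2 p U - (E * U ^+ p * frob2 p U) *+ p.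
Proof.
have [E0 QpE] := fps_frob_lift p_prime (fps_frob_lift (phi := idfun) p_prime R_lift) Q.
rewrite -/(frob2 p) in QpE.
have Db : supp2 (box (p * h) p (p * D)) (Q ^+ p - frob2 p Q).
  apply: supp2B; first by have := box_exp (n := p) Q_box; rewrite muln1.
  apply: supp2_frob Q_box => i j /and3P[iA iB jC].
  by apply/and3P; split; nia.
have E0P : Q ^+ p - frob2 p Q = E0 *+ p by rewrite QpE addrC addKr.
exists (restrict2 (box (p * h) p (p * D)) E0); first exact: supp2_restrict.
have psiQU : frob2 p Q * frob2 p U = 1.
  by rewrite -(rmorphM (fps_frob p (fps_frob p idfun))) QU rmorph1.
have QpU : Q ^+ p * U ^+ p = 1 by rewrite -exprMn QU expr1n.
rewrite -2!mulrnAl -(supp2_divMn Db E0P) !mulrBl QpU mul1r opprB addrC subrK.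
by rewrite mulrAC psiQU mul1r.
Qed.

(** The blocks U^p are turned into Frobenius twists of U one at a time. By [frob_inverse] each
    exchange leaves an error with one more twisted block and a factor [p], so its precision [a] is
    one less; hence the double induction. *)
Lemma level_sect_mixed ex ey a i j r T : (r < p)%N ->
  supp2 (box (p * (i + j).+1 * h + ex) (p * (i + j).+1).-1
             (p * (i + j).+1 * D + ey)) T ->
  level (ex %/ p) (ey %/ p) a (i + j)
        (sect2 p r (T * U ^+ (p * i) * frob2 p U ^+ j.+1)).
Proof.
move=> lt_rp; have p_gt0 := prime_gt0 p_prime.
have [E Eb UpE] := frob_inverse.
elim: a i j T => // a IHa; elim=> [|i IHi] j T Tb.
  (* All blocks are twisted and leave the section as U^(j+1). The lower bound in y becomes (p(j+1) -
     1)/p rounded down, that is j, as [tbox] demands. *)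
  rewrite muln0 expr0 mulr1 add0n -(rmorphXn (fps_frob p (fps_frob p idfun))) sect2_frob //.
  apply: level_num; apply: box_le (box_sect2 (r := r) p_gt0 Tb).
  - by rewrite -mulnA mulnC divnMDl // mulnC.
  - by rewrite add0n -ltnS; rewrite ltn_divLR // mulnC; have := muln_gt0 p j.+1; lia.
  - by rewrite -mulnA mulnC divnMDl // mulnC.
have -> : T * U ^+ (p * i.+1) * frob2 p U ^+ j.+1 =
    T * U ^+ (p * i) * frob2 p U ^+ j.+2
    - (T * E * U ^+ (p * i.+1) * frob2 p U ^+ j.+2) *+ p.
  rewrite mulnS exprD {1}UpE [frob2 p U ^+ j.+2]exprS; ring.
rewrite sect2B sect2Mn; apply: levelD.
  by rewrite addSnnS; apply: IHi; rewrite -addSnnS.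
apply/levelN/level_mulp; rewrite -addnS; apply: IHa.
apply: box_le (boxM Tb Eb); rewrite addnS; nia.
Qed.

(** [level_sect_mixed] assumes a twisted block; the first one is created here. *)
Lemma level_sect_pow ex ey a n r T : (r < p)%N ->
  supp2 (box (p * n.+1 * h + ex) (p * n.+1).-1 (p * n.+1 * D + ey)) T ->
  level (ex %/ p) (ey %/ p) a n (sect2 p r (T * U ^+ (p * n.+1))).
Proof.
move=> lt_rp Tb; have [E Eb UpE] := frob_inverse; case: a => // a.
have -> : T * U ^+ (p * n.+1) = T * U ^+ (p * n) * frob2 p U ^+ 1
    - (T * E * U ^+ (p * n.+1) * frob2 p U ^+ 1) *+ p.
  rewrite mulnS exprD {1}UpE expr1; ring.
rewrite sect2B sect2Mn; apply: levelD.
  by have := @level_sect_mixed ex ey a.+1 n 0 r T lt_rp; rewrite addn0; apply.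
apply/levelN/level_mulp.
have := @level_sect_mixed ex ey a n.+1 0 r (T * E) lt_rp; rewrite addn0; apply.
by apply: box_le (boxM Tb Eb); nia.
Qed.

(** Every denominator is first padded to an exponent p(n+1) with n = m/p rounded down; the section
    then divides the exponent and the excesses by [p]. *)
Lemma level_sect ex ey a m r f : (r < p)%N -> level ex ey a m f ->
  level (ex %/ p) (ey %/ p) a (m %/ p) (sect2 p r f).
Proof.
move=> lt_rp; have p_gt0 := prime_gt0 p_prime; have p_gt1 := prime_gt1 p_prime.
elim: a m f => // a IHa m f [T [g [Tb gl ->]]].
rewrite sect2D sect2Mn; apply: levelD; last first.
  apply: level_mulp; apply: level_le_den (IHa _ _ gl).
  by rewrite -ltnS -[X in (_ < X)%N]addn2 -(mulnK 2 p_gt0) ltn_divLR //; lia.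
set n := (m %/ p)%N; have mn : (m.+1 <= p * n.+1)%N by rewrite mulnC ltn_ceil.
have -> : T * U ^+ m.+1 = T * Q ^+ (p * n.+1 - m.+1) * U ^+ (p * n.+1).
  rewrite -[in U ^+ (p * _)](subnK mn) exprD -!mulrA; congr (_ * _).
  by rewrite mulrA -exprMn QU expr1n mul1r.
apply: level_sect_pow => //.
apply: box_le (boxM Tb (box_exp (n := p * n.+1 - m.+1) Q_box)).
- by rewrite addnAC -mulnDl subnKC.
- by rewrite muln1; lia.
- by rewrite addnAC -mulnDl subnKC.
Qed.
End Levels.

(** * Enumeration of the quotients *)

Definition digits_mod (R : comNzRingType) (p : nat) (s : seq R) : Prop :=
  size s = p /\ forall c : R, exists d e, d \in s /\ c = d + e *+ p.

Section Enumeration.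
Variables (R : comNzRingType) (p : nat) (digits : seq R).
Hypothesis digitsP : digits_mod p digits.
Implicit Types (f g T : fps (fps R)).

Lemma supp2_enum (pos : seq (nat * nat)) :
  exists L : seq (fps (fps R)), size L = (p ^ size pos)%N /\
    forall T, supp2 (fun i j => (i, j) \in pos) T ->
      exists t T', [/\ t \in L, supp2 (fun i j => (i, j) \in pos) T'
                     & T = t + T' *+ p].
Proof.
have [sz_d dP] := digitsP.
elim: pos => [|[i j] pos [L [sz_L LP]]].
  exists [:: 0]; split=> // T T0; exists 0, 0; rewrite mem_seq1 mul0rn addr0.
  split=> //; first exact: supp2_0.
  by apply: bfps_ext => i j; apply: contrapT => /eqP /T0.
pose mono c : fps (fps R) := fps_mono (fps_mono c i) j.
exists [seq mono c + t | c <- digits, t <- L]; split.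
  by rewrite size_allpairs sz_d sz_L expnS.
move=> T Tpos; have [c [e [cd Tc]]] := dP (T j i).
have monoE b k l : mono b l k = if (l == j) && (k == i) then b else 0.
  by rewrite /mono /=; case: eqP.
have mono_supp b : supp2 (fun k l => (k, l) \in (i, j) :: pos) (mono b).
  move=> k l; rewrite monoE; case: ifP => [/andP[/eqP -> /eqP ->]|_]; last by rewrite eqxx.
  by rewrite mem_head.
pose T1 := restrict2 (fun k l => (k, l) != (i, j)) T.
have [|t [T' [tL T'pos T1E]]] := LP T1.
  move=> k l; rewrite /T1 /=; case: ifP => [kl /Tpos|_]; last by rewrite eqxx.
  by rewrite inE (negPf kl).
exists (mono c + t), (mono e + T'); split.
- by apply/allpairsP; exists (c, t).
- apply: supp2D => //; apply: supp2_sub T'pos => k l kl.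
  by rewrite inE kl orbT.
rewrite mulrnDl addrACA -T1E; apply: bfps_ext => k l.
rewrite -[RHS]/((mono c + mono e *+ p) l k + T1 l k).
rewrite -[(mono c + _) l k]/(mono c l k + (mono e *+ p) l k) coef_bfpsMn !monoE /=.
rewrite xpair_eqE andbC; case: andP => [[/eqP -> /eqP ->]|_] /=.
  by rewrite addr0 Tc.
by rewrite mul0rn !add0r.
Qed.

Variables (h D : nat) (Q U : fps (fps R)).
Hypothesis p_prime : prime p.
Hypothesis R_lift : frob_lift p (@idfun R).
Hypothesis Q_box : supp2 (box h 1 D) Q.
Hypothesis QU : Q * U = 1.
Local Notation tbox := (tbox h D 0 0).
Local Notation level := (level p h D U 0 0).

(* Numerators only matter up to the diagonal of the quotient, so [pos m] may be
   smaller than the box; this is needed when h = d = 1. *)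
Variable pos : nat -> seq (nat * nat).
Hypothesis pos_box : forall m i j, (i, j) \in pos m -> tbox m i j.
Hypothesis pos_diag : forall m T, supp2 (tbox m) T ->
  exists2 T1, supp2 (fun i j => (i, j) \in pos m) T1 &
    diag (T * U ^+ m.+1) = diag (T1 * U ^+ m.+1).

Lemma pos_decomp m : exists L : seq (fps (fps R)), size L = (p ^ size (pos m))%N /\
  forall T, supp2 (tbox m) T -> exists t T', [/\ t \in L, supp2 (tbox m) T'
    & diag (T * U ^+ m.+1) = diag (t * U ^+ m.+1 + T' * U ^+ m.+1 *+ p)].
Proof.
have [L [sz_L LP]] := supp2_enum (pos m); exists L; split=> // T /pos_diag[T1 T1p ->].
have [t [T' [tL T'p ->]]] := LP T1 T1p; exists t, T'; split=> //.
  by apply: supp2_sub T'p => i j; apply: pos_box.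
by rewrite mulrDl mulrnAl.
Qed.

(** The numerators are reduced modulo [p] in turn. A carry p T'/Q^(m+1) is expanded by [Q] and
    absorbed by the next numerator; [b] counts the factors [p] in front, and p^alpha = 0 ends the
    process. *)
Lemma level_enum alpha : (p ^ alpha)%:R = 0 :> R -> forall a b m, (a + b = alpha)%N ->
  exists L : seq (fps R), size L = (p ^ \sum_(i < a) size (pos (m + i)))%N /\
    forall f, level a m f -> diag f *+ p ^ b \in L.
Proof.
move=> p_alpha; elim=> [|a IHa] b m ab.
  exists [:: 0]; rewrite big_ord0; split=> // f _; rewrite mem_seq1.
  apply/eqP/fps_ext => n; rewrite coef_fpsMn -mulr_natr -[b]add0n ab p_alpha.
  exact: mulr0.
have [L [sz_L LP]] := IHa b.+1 m.+1 (etrans (esym (addSnnS a b)) ab).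
have [Lm [sz_Lm LmP]] := pos_decomp m.
exists [seq diag (t * U ^+ m.+1) *+ p ^ b + s | t <- Lm, s <- L]; split.
  rewrite size_allpairs sz_L sz_Lm -expnD big_ord_recl addn0; congr (_ ^ (_ + _))%N.
  by apply: eq_bigr => i _; rewrite addSnnS.
move=> f [T [g [Tb gl ->]]]; have [t [T' [tL T'b TE]]] := LmP T Tb.
apply/allpairsP; exists (t, diag (T' * U ^+ m.+1 + g) *+ p ^ b.+1); split=> //=.
  apply: LP; apply: levelD => //; apply: (levelS Q_box QU).
  exact: level_num.
by rewrite diagD TE !diagD !diagMn expnS mulrnA mulrnDl !mulrnDl addrA.
Qed.

(** The first numerator is enumerated before its section is taken, together with the digit r: this
    is the term [size (pos 0) + 1]. Its carry passes through the section as well and joins g over Q,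
    ..., Q^a. *)
Lemma state_enum a : (p ^ a.+1)%:R = 0 :> R ->
  exists L : seq (fps R),
    size L = (p ^ (size (pos 0) + 1 + \sum_(i < a) size (pos i)))%N /\
    forall r T g, (r < p)%N -> supp2 (tbox 0) T -> level a 0 g ->
      diag (sect2 p r (T * U) + g *+ p) \in L.
Proof.
move=> p_alpha; have [L [sz_L LP]] := level_enum p_alpha 0 (addn1 a).
have [L0 [sz_L0 L0P]] := pos_decomp 0.
exists [seq sr + s | sr <- [seq sect1 p r (diag (t * U)) | t <- L0, r <- iota 0 p],
               s <- L]; split.
  by rewrite !size_allpairs size_iota sz_L0 sz_L !expnD expn1.
move=> r T g lt_rp Tb gl; have [t [T' [tL T'b TE]]] := L0P T Tb.
apply/allpairsP.
exists (sect1 p r (diag (t * U)), diag (sect2 p r (T' * U) + g) *+ p); split=> //=.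
- by apply/allpairsP; exists (t, r); rewrite mem_iota.
- rewrite -[X in _ *+ X]expn1; apply: LP; apply: levelD => //.
  rewrite -[0%N](div0n p); apply: (level_sect Q_box QU p_prime R_lift) => //.
  by have := level_num p U a T'b; rewrite expr1.
rewrite expr1 in TE; rewrite diagD diag_sect2 TE !diagD !diagMn sect1D sect1Mn.
by rewrite diag_sect2 mulrnDl addrA.
Qed.
End Enumeration.

(** * Automata and kernels *)

Section Words.
Variables (R : comNzRingType) (p : nat).
Implicit Types (f : fps (fps R)) (b : fps R) (w : seq 'I_p).

Definition sect1w b w : fps R := foldl (fun g (r : 'I_p) => sect1 p r g) b w.
Definition sect2w f w : fps (fps R) := foldl (fun g (r : 'I_p) => sect2 p r g) f w.

Lemma diag_sect2w f w : diag (sect2w f w) = sect1w (diag f) w.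
Proof. by elim: w f => //= r w IHw f; rewrite -diag_sect2 -IHw. Qed.

Lemma coef_sect1w b w n :
  sect1w b w n = b (p ^ size w * n + foldr (fun (c : 'I_p) m => c + p * m) 0 w)%N.
Proof.
elim: w b => [|r w IHw] b /=; first by rewrite mul1n addn0.
by rewrite IHw /=; congr (b _); rewrite expnS; lia.
Qed.

Lemma kernel_tree b u : exists L : seq (fps R), size L = (\sum_(i < u) p ^ i)%N /\
  forall w, (size w < u)%N -> sect1w b w \in L.
Proof.
exists [seq sect1w b w | w <-
  flatten [seq map val (enum {: i.-tuple 'I_p}) | i <- iota 0 u]].
split=> [|w lt_wu].
  rewrite size_map size_flatten /shape -map_comp sumnE big_map.
  rewrite -{1}[u]subn0 -/(index_iota 0 u) big_mkord; apply: eq_bigr => i _.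
  by rewrite /= size_map -cardE card_tuple card_ord.
apply/map_f/flatten_mapP; exists (size w); first by rewrite mem_iota.
by apply/mapP; exists (in_tuple w) => //; rewrite mem_enum.
Qed.

(** The distinct sections of b serve as states, each with its constant coefficient as output; a
    final digit 0 keeps that coefficient. This automaton bounds the least size, and an automaton of
    least size is then chosen. *)
Lemma minimal_dfao_of_kernel b (s : seq (fps R)) : (1 < p)%N ->
  (forall w, sect1w b w \in s) ->
  exists M : dfao p R, minimal_dfao M b /\ (dfao_size M <= size s)%N.
Proof.
move=> p_gt1 bs.
pose K := undup [seq f <- s | `[< exists w, f = sect1w b w >]].
have KP w : sect1w b w \in K.
  by rewrite mem_undup mem_filter bs andbT; apply/asboolP; exists w.
have KS (q : seq_sub K) (r : 'I_p) : sect1 p r (val q) \in K.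
  have := valP q; rewrite mem_undup mem_filter => /andP[/asboolP[w ->] _].
  by have := KP (rcons w r); rewrite /sect1w foldl_rcons.
pose M0 := @Dfao p R (seq_sub K) (SeqSub (KP [::]))
  (fun q r => SeqSub (KS q r)) (fun q => val q 0%N).
have M0E w : dfao_output M0 w = sect1w b w 0%N.
  have foldE q : val (foldl (@dfao_trans p R M0) q w) = sect1w (val q) w.
    by elim: w q => //= r w IHw q; rewrite IHw.
  by rewrite -[RHS]/(sect1w (val (dfao_init M0)) w 0%N) -foldE.
pose good k := `[< exists M : dfao p R,
  [/\ generates M b, ignores_leading_zeros M & dfao_size M = k] >].
have good0 : good (dfao_size M0).
  apply/asboolP; exists M0; split=> //.
    by move=> n w [wn _]; rewrite M0E coef_sect1w muln0 wn.
  move=> w z z0; rewrite !M0E /sect1w foldl_rcons /=.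
  by rewrite muln0 z0.
have [k /asboolP[M [Mb M0s Mk]] k_min] := ex_minnP (ex_intro (fun k => good k) _ good0).
exists M; split; last first.
  apply: leq_trans (_ : (size K <= _)%N); last first.
    by apply: leq_trans (size_undup _) _; rewrite size_filter count_size.
  by rewrite Mk (leq_trans (k_min _ good0)) // /dfao_size card_seq_sub ?undup_uniq.
split=> // M' M'b M'0; rewrite Mk; apply: k_min; apply/asboolP; by exists M'.
Qed.
End Words.

(** * States reached after sufficiently many digits *)

Section States.
Variables (R : comNzRingType) (p : nat) (digits : seq R).
Hypothesis digitsP : digits_mod p digits.
Variables (h D : nat) (Q U : fps (fps R)).
Hypothesis p_prime : prime p.
Hypothesis R_lift : frob_lift p (@idfun R).
Hypothesis Q_box : supp2 (box h 1 D) Q.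
Hypothesis QU : Q * U = 1.
Implicit Types (f T g : fps (fps R)) (w : seq 'I_p).
Local Notation tbox := (tbox h D 0 0).
Local Notation level := (level p h D U).

(** Only the part divisible by [p] may carry an excess: modulo [p] the numerator already fits the
    box. *)
Definition state ex ey a f := exists T g,
  [/\ supp2 (tbox 0) T, level ex ey a 1 g & f = T * U + g *+ p].

Lemma state_sect ex ey a r f : (r < p)%N -> state ex ey a f ->
  state (ex %/ p) (ey %/ p) a (sect2 p r f).
Proof.
move=> lt_rp [T [g [Tb gl ->]]]; rewrite sect2D sect2Mn.
have := level_num p U a.+1 Tb; rewrite expr1.
case/(level_sect Q_box QU p_prime R_lift lt_rp) => T' [g' [T'b g'l ->]].
rewrite div0n in T'b g'l *; exists T', (g' + sect2 p r g).
split=> //; last by rewrite expr1 mulrnDl addrA.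
apply: levelD; first by apply: level_le g'l.
apply: (level_le_den Q_box QU) (level_sect Q_box QU p_prime R_lift lt_rp gl).
exact: leq_div.
Qed.

Lemma state_sectw ex ey a f w : state ex ey a f ->
  state (ex %/ p ^ size w) (ey %/ p ^ size w) a (sect2w f w).
Proof.
elim: w ex ey f => [|r w IHw] ex ey f; first by rewrite !divn1.
by move=> /(state_sect (ltn_ord r)) /IHw; rewrite /= expnS !divnMA.
Qed.

(** The last digit is kept apart. Its section lowers the denominators of the multiple of [p] from
    Q^2 onwards to Q onwards, since 1/p rounds to 0, and [u] digits have divided the excess down to
    0. *)
Lemma state_late ex ey a f u w : state ex ey a f ->
  (0 < u)%N -> (ex < p ^ u)%N -> (ey < p ^ u)%N -> (u <= size w)%N ->
  exists (r : 'I_p) T g, [/\ supp2 (tbox 0) T, level 0 0 a 0 g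
    & sect2w f w = sect2 p r (T * U) + g *+ p].
Proof.
move=> fs u_gt0 ex_u ey_u; case: (lastP w) => [|{}w r]; first by rewrite leqNgt u_gt0.
rewrite size_rcons => le_u; rewrite /sect2w foldl_rcons -/(sect2w f w).
have [T [g [Tb gl ->]]] := state_sectw w fs.
exists r, T, (sect2 p r g); split=> //; last by rewrite sect2D sect2Mn.
have := level_sect Q_box QU p_prime R_lift (ltn_ord r) gl.
rewrite -!divnMA -!expnSr [(1 %/ p)%N]divn_small ?prime_gt1 //.
have le_p : (p ^ u <= p ^ (size w).+1)%N by rewrite leq_pexp2l ?prime_gt0.
by rewrite ![(_ %/ p ^ _)%N]divn_small //; apply: leq_trans le_p.
Qed.

Variable pos : nat -> seq (nat * nat).
Hypothesis pos_box : forall m i j, (i, j) \in pos m -> tbox m i j.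
Hypothesis pos_diag : forall m T, supp2 (tbox m) T ->
  exists2 T1, supp2 (fun i j => (i, j) \in pos m) T1 &
    diag (T * U ^+ m.+1) = diag (T1 * U ^+ m.+1).

Lemma state_kernel ex ey a f u : (p ^ a.+1)%:R = 0 :> R -> state ex ey a f ->
  (0 < u)%N -> (ex < p ^ u)%N -> (ey < p ^ u)%N ->
  exists L : seq (fps R),
    size L = (p ^ (size (pos 0) + 1 + \sum_(i < a) size (pos i)))%N /\
    forall w, (u <= size w)%N -> sect1w (diag f) w \in L.
Proof.
move=> p_alpha fs u_gt0 ex_u ey_u.
have [L [sz_L LP]] := state_enum digitsP p_prime R_lift Q_box QU pos_box pos_diag p_alpha.
exists L; split=> // w le_u; rewrite -diag_sect2w.
have [r [T [g [Tb gl ->]]]] := state_late fs u_gt0 ex_u ey_u le_u.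
exact: LP.
Qed.
End States.

(** * Furstenberg's formula *)

Section Shear.
Variable R : comNzRingType.

(* [f(x)] as a series in [x = XY]. *)
Definition shear (f : fps R) : fps (fps R) := Fps (fun j => fps_mono (f j) j).

Fact shear_zmod : zmod_morphism shear.
Proof.
move=> f g; apply: bfps_ext => i j; rewrite /= -[RHS]/(shear f j i - shear g j i) /=.
by case: eqP; rewrite ?subr0.
Qed.

Fact shear_monoid : monoid_morphism shear.
Proof.
split=> [|f g]; apply: fps_ext => j.
  rewrite [LHS]/= coef_fps1; apply: fps_ext => i.
  by case: j => [|j]; rewrite /= !coefC //=; case: eqP; rewrite ?coefC.
rewrite coef_fpsM -[LHS]/(fps_mono ((f * g) j) j).
under eq_bigr => l _ do rewrite fps_monoM (subnKC (leq_ord l)).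
apply: fps_ext => i; rewrite coef_fps_sum /=.
by case: eqP => // _; rewrite big1.
Qed.

HB.instance Definition _ :=
  GRing.isZmodMorphism.Build (fps R) (fps (fps R)) shear shear_zmod.
HB.instance Definition _ :=
  GRing.isMonoidMorphism.Build (fps R) (fps (fps R)) shear shear_monoid.

Definition fpsY : fps (fps R) := fps_mono 1 1.

Lemma coef_fpsYM (f : fps (fps R)) j : (fpsY * f) j = if j is j'.+1 then f j' else 0.
Proof. by rewrite coef_monoM mul1r; case: j => // j; rewrite subn1. Qed.

Definition shear_eval (H : {poly (fps R)}) : fps (fps R) := (map_poly shear H).[fpsY].

Lemma shear_evalD : {morph shear_eval : H K / H + K}.
Proof. by move=> H K; rewrite /shear_eval rmorphD hornerD. Qed.

Lemma shear_evalM : {morph shear_eval : H K / H * K}.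
Proof. by move=> H K; rewrite /shear_eval rmorphM hornerM. Qed.

Lemma shear_evalXsubC f : shear_eval ('X - f%:P) = fpsY - shear f.
Proof. by rewrite /shear_eval map_polyXsubC hornerXsubC. Qed.

Lemma coef_shear_eval H i j :
  shear_eval H j i = if (i <= j)%N then H`_(j - i) i else 0.
Proof.
pose n := maxn (size H) j.+1.
have szH : (size (map_poly shear H) <= n)%N.
  by rewrite (leq_trans (size_poly _ _)) // leq_maxl.
rewrite /shear_eval (horner_coef_wide _ szH) coef_fps_sum coef_fps_sum.
have E (k : 'I_n) : ((map_poly shear H)`_k * fpsY ^+ k) j i =
    if (k <= j)%N && (i == j - k)%N then H`_k i else 0.
  rewrite coef_map fps_mono_exp expr1n mul1n mulrC coef_monoM mul1r.
  by case: leqP => //= _; case: eqP => // ->.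
under eq_bigr => k _ do rewrite E.
case: leqP => [le_ij|lt_ji].
  have lt_k : (j - i < n)%N by rewrite /n leq_max ltnS leq_subr orbT.
  rewrite (bigD1 (Ordinal lt_k)) //= big1 => [|k].
    by rewrite addr0 leq_subr subKn // eqxx.
  rewrite -val_eqE /= => ne_k; case: ifP => // /andP[le_k /eqP e_i].
  by case/eqP: ne_k; lia.
by rewrite big1 // => k _; case: ifP => // /andP[_ /eqP]; lia.
Qed.

Lemma coef_shear f i j : shear f j i = if i == j then f i else 0.
Proof. by rewrite /=; case: eqP => // ->. Qed.
End Shear.

Section Furstenberg.
Variables (R : comNzRingType) (P : {poly {poly R}}) (F : fps R) (c : R).
Hypotheses (P00 : P`_0`_0 = 0) (P10 : P`_1`_0 * c = 1) (F0 : F 0%N = 0).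
Hypothesis PF : (map_poly (@fps_of_poly R) P).[F] = 0.

(* P(XY, Y) / Y *)
Definition shear_den : fps (fps R) := Fps (fun j => Fps (fun i =>
  if (i <= j.+1)%N then P`_(j.+1 - i)`_i else 0)).

(* Y (dP/dy)(XY, Y) - d P(XY, Y): the last term contributes - d Y, of zero
   diagonal, to the quotient by [shear_den] and lowers the degree in y. *)
Definition shear_num d : fps (fps R) := Fps (fun j => Fps (fun i =>
  if (i <= j)%N then P`_(j - i)`_i *+ (j - i) - P`_(j - i)`_i *+ d else 0)).

Lemma shear_den00 : shear_den 0%N 0%N * c = 1.
Proof. exact: P10. Qed.

Local Notation PF_ := (map_poly (@fps_of_poly R) P).

Lemma coef_fps_map k i : PF_`_k i = P`_k`_i.
Proof.
by rewrite coef_map_id0 //=; apply: fps_ext => n; rewrite /= coef0.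
Qed.

Lemma shear_evalP : shear_eval PF_ = fpsY R * shear_den.
Proof.
apply: bfps_ext => i [|j]; rewrite coef_shear_eval coef_fpsYM; last first.
  by rewrite /= coef_fps_map.
by case: i => //; rewrite coef_fps_map.
Qed.

(** Factor P as H times y - F. With x = XY and y = Y the quotient becomes Y/(1 - W) + Y^2 H'/H - d
    Y, where W = F(XY)/Y. Only the term F(XY) of Y/(1 - W) meets the diagonal: its later terms have
    more X than Y, everything else more Y than X. *)
Lemma furstenberg_formula d U : shear_den * U = 1 -> diag (shear_num d * U) = F.
Proof.
move=> GU; set Y := fpsY R.
have Yinj f g : Y * f = Y * g -> f = g.
  move=> e; apply: fps_ext => j; move/(congr1 (fun f : fps (fps R) => f j.+1)): e.
  by rewrite !coef_fpsYM.
have /factor_theorem[H PE] : root PF_ F by apply/eqP.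
(* [W] is F(XY)/Y, a power series because F(0) = 0. *)
pose W : fps (fps R) := Fps (fun j => Fps (fun i => if i == j.+1 then F i else 0)).
have YW : Y * W = shear F.
  apply: bfps_ext => i [|j]; rewrite coef_fpsYM coef_shear //=.
  by case: eqP => // ->.
have GE : shear_den = (1 - W) * shear_eval H.
  apply: Yinj; rewrite -shear_evalP PE shear_evalM shear_evalXsubC -YW -/Y; ring.
pose H' := shear_eval H^`().
have dPE : shear_eval PF_^`() = shear_eval H + Y * (1 - W) * H'.
  rewrite PE derivM derivXsubC mulr1 shear_evalD shear_evalM shear_evalXsubC -YW -/Y /H'.
  ring.
have numE : shear_num d = Y * shear_eval PF_^`() - Y * shear_den *+ d.
  rewrite -shear_evalP; apply: bfps_ext => i j.
  rewrite -[RHS]/((Y * shear_eval PF_^`()) j i - (shear_eval PF_ *+ d) j i).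
  rewrite coef_bfpsMn coef_shear_eval coef_fpsYM /=.
  case: j => [|j].
    by case: i => [|i]; rewrite ?mul0rn ?subr0 //= coef_fps_map mulr0n P00 mul0rn subr0.
  rewrite coef_shear_eval; case: (ltngtP i j.+1) => [|lt_ji|->].
  - rewrite ltnS => le_ij; rewrite le_ij coef_deriv coef_fpsMn !coef_fps_map subSn //.
  - by rewrite leqNgt (ltn_trans _ lt_ji) // mul0rn subr0.
  - by rewrite ltnn subnn coef_fps_map mulr0n.
(* [De] is 1/(1 - W) and [K] is the inverse of H(XY, Y). *)
pose De := U * shear_eval H; pose K := U * (1 - W).
have DeW : (1 - W) * De = 1 by rewrite /De -[RHS]GU GE; ring.
have HK : shear_eval H * K = 1 by rewrite /K -[RHS]GU GE; ring.
have -> : shear_num d * U = Y + shear F + shear F * (W * De) + Y ^+ 2 * H' * K - Y *+ d.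
  rewrite numE dPE mulrBl mulrnAl -[Y * shear_den * U]mulrA GU mulr1.
  congr (_ - _).
  have -> : Y + shear F + shear F * (W * De) = Y * De.
    rewrite -YW.
    transitivity (Y * ((1 - W) * De) + Y * W * ((1 - W) * De) + Y * W * (W * De)).
      by rewrite DeW !mulr1.
    ring.
  rewrite /K /De; ring.
have W_supp : supp2 (fun i j => i = j.+1) W.
  by move=> i j /=; case: (i =P j.+1) => // _; rewrite eqxx.
have De_supp : supp2 (fun i j => (j <= i)%N) De.
  apply: (@supp2_inv _ _ (1 - W) De 1) => //; first by move=> i j k l; lia.
    apply: supp2B; first exact: supp2_1.
    by apply: supp2_sub W_supp => i j ->.
  by rewrite -[(1 - W) 0%N 0%N]/((1 : fps (fps R)) 0%N 0%N - 0 : R) subr0 !coef_fps1 mulr1.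
have eval_supp H1 : supp2 (fun i j => (i <= j)%N) (shear_eval H1).
  by move=> i j; rewrite coef_shear_eval; case: ifP; rewrite ?eqxx.
have K_supp : supp2 (fun i j => (i <= j)%N) K.
  apply: (@supp2_inv _ _ (shear_eval H) K c) => //.
    by move=> i j k l; lia.
  rewrite -shear_den00 GE; congr (_ * _); rewrite coef_bfpsM !big_ord1.
  rewrite -[(1 - W) 0%N 0%N]/((1 : fps (fps R)) 0%N 0%N - 0 : R) subr0 !coef_fps1 mul1r.
  by [].
have Y_supp : supp2 (fun i j => j = i.+1) Y.
  move=> i [|j]; rewrite -[Y]mulr1 coef_fpsYM ?eqxx // => /(supp2_1 (S := fun i j => i = j)).
  by move=> ->.
have shear_supp f : supp2 (fun i j => i = j) (shear f).
  by move=> i j; rewrite coef_shear; case: (i =P j) => // _; rewrite eqxx.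
have -> : Y + shear F + shear F * (W * De) + Y ^+ 2 * H' * K - Y *+ d =
    shear F + (shear F * (W * De) + (Y * Y * (H' * K) + (Y - Y *+ d))) by ring.
rewrite diagD [diag (_ + _)](diag_supp0 (S := fun i j => i <> j)) //.
- by rewrite addr0; apply: fps_ext => n; rewrite /= eqxx.
- by move=> i; apply.
apply: supp2D.
  apply: (@supp2M _ (fun i j => i = j) (fun i j => (j < i)%N)) => //.
    by move=> i j k l; lia.
  by apply: supp2M W_supp De_supp => i j k l; lia.
apply: supp2D.
  apply: (@supp2M _ (fun i j => (i < j)%N) (fun i j => (i <= j)%N)).
  - by move=> i j k l; lia.
  - by apply: (supp2M _ Y_supp Y_supp) => i j k l; lia.
  - apply: (@supp2M _ (fun i j => (i <= j)%N) (fun i j => (i <= j)%N)) => //.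
      by move=> i j k l; lia.
    exact: eval_supp.
have Y_supp' : supp2 (fun i j => i <> j) Y by apply: supp2_sub Y_supp => i j; lia.
by apply: supp2B => //; apply: supp2Mn.
Qed.
End Furstenberg.

(** * Univariate periodicity *)

Section FiniteField.
Variable K : finFieldType.
Implicit Types f g : {poly K}.

(** In the finite field K[X]/(f) every element, in particular the class of X, is fixed by the power
    given by the cardinality. *)
Lemma irreducible_dvd_Xq f : irreducible_poly f -> f \is monic ->
  f %| 'X^(#|K| ^ (size f).-1) - 'X.
Proof.
move=> f_irr f_mon; pose hI : monic_irreducible_poly f := (f_irr, f_mon).
have := expf_card (in_qpoly f 'X : {poly %/ f with hI}).
rewrite card_qfpoly => e.
have : in_qpoly f ('X^(#|K| ^ (size f).-1) - 'X) = 0.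
  by rewrite rmorphB rmorphXn; apply/eqP; rewrite subr_eq0; apply/eqP.
move/val_eqP => /=.
by rewrite -Pdiv.IdomainMonic.modpE ?(mk_monicE hI).
Qed.

Lemma dvd_Xq_iter f N k : f %| 'X^N - 'X -> f %| 'X^(N ^ k) - 'X.
Proof.
move=> fN; elim: k => [|k IHk]; first by rewrite expr1 subrr dvdp0.
rewrite expnSr exprM -(subrK ('X^N) (_ ^+ N)) -addrA; apply: dvdp_add => //.
by rewrite subrXX dvdp_mulr.
Qed.

Lemma irreducible_dvd_Xq1 f n : irreducible_poly f -> f \is monic -> ~~ root f 0 ->
  ((size f).-1 %| n)%N -> f %| 'X^(#|K| ^ n - 1) - 1.
Proof.
move=> f_irr f_mon f0 /dvdnP[k ->]; rewrite -coprimepX in f0.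
rewrite -(Gauss_dvdpr _ f0) mulrBr mulr1 -exprS -subSn ?expn_gt0 ?subSS ?subn0.
  by rewrite mulnC expnM; apply/dvd_Xq_iter/irreducible_dvd_Xq.
by apply/orP; left; apply/card_gt0P; exists 0.
Qed.

Lemma monic_irreducible_divisor g : (1 < size g)%N ->
  exists f, [/\ irreducible_poly f, f \is monic & f %| g].
Proof.
move=> sz_g; pose good k := `[< exists f, [/\ (1 < size f)%N, f %| g & size f = k] >].
have gg : good (size g) by apply/asboolP; exists g.
have [k /asboolP[f [sz_f fg fk]] k_min] := ex_minnP (ex_intro (fun k => good k) _ gg).
have f0 : f != 0 by rewrite -size_poly_gt0 ltnW.
have lf0 : (lead_coef f)^-1 != 0 by rewrite invr_eq0 lead_coef_eq0.
exists ((lead_coef f)^-1 *: f); split; last by rewrite dvdpZl.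
  split=> [|q sz_q]; first by rewrite size_scale.
  rewrite dvdpZr // => qf; have q0 : q != 0 by apply: dvdpN0 qf f0.
  apply: (@eqp_trans _ f); last by rewrite eqp_sym eqp_scale.
  rewrite -dvdp_size_eqp //; apply/eqP/anti_leq; rewrite dvdp_leq //= fk.
  apply: k_min; apply/asboolP; exists q; split=> //; last exact: dvdp_trans fg.
  by rewrite ltn_neqAle eq_sym sz_q size_poly_gt0.
by rewrite monicE lead_coefZ mulVf // lead_coef_eq0.
Qed.

(** [s] lists the degrees of the irreducible factors of g with multiplicity. Each factor divides
    X^(q^n - 1) - 1, and there are at most deg g of them. *)
Lemma dvd_Xq1_exp g : ~~ root g 0 -> exists s : seq nat,
  [/\ all (leq 1) s, sumn s = (size g).-1
    & forall n, (lcm_seq s %| n)%N -> g %| ('X^(#|K| ^ n - 1) - 1) ^+ (size g).-1].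
Proof.
move: {2}(size g) (leqnn (size g)) => k; elim: k g => [|k IHk] g le_k g0.
  by move: g0; rewrite (size_poly_leq0P _ le_k) root0.
have gn0 : g != 0 by apply: contraNneq g0 => ->; rewrite root0.
have [le_g1|gt_g1] := leqP (size g) 1.
  exists [::]; have -> : size g = 1%N.
    by apply/anti_leq; rewrite le_g1 size_poly_gt0.
  by split=> // n _; rewrite dvdp1 eqn_leq le_g1 size_poly_gt0.
have [f [f_irr f_mon fg]] := monic_irreducible_divisor gt_g1.
have [g' gE] : exists g' : {poly K}, g = g' * f by apply/dvdpP.
have [f0 g'0] : ~~ root f 0 /\ ~~ root g' 0.
  by move: g0; rewrite gE rootM negb_or => /andP[].
have fn0 : f != 0 by apply: monic_neq0.
have g'n0 : g' != 0 by apply: contraNneq g'0 => ->; rewrite root0.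
have [sz_f _] := f_irr.
have [a fa] : exists a, size f = a.+2 by exists (size f).-2; case: (size f) sz_f => [|[]].
have [b gb] : exists b, size g' = b.+1.
  by exists (size g').-1; rewrite prednK // size_poly_gt0.
have szE : size g = (a + b).+2 by rewrite gE size_mul // fa gb addSn /= !addnS addnC.
rewrite szE ltnS in le_k *.
have [|s] := IHk g' _ g'0; rewrite gb; first by apply: leq_trans le_k; rewrite ltnS leq_addl.
case=> s1 s_sum sP; exists (a.+1 :: s); split; first by [].
  by rewrite /= s_sum addSn.
move=> n; rewrite /lcm_seq big_cons -/(lcm_seq s) dvdn_lcm => /andP[fn sn].
have -> : (a + b).+2.-1 = (b + a.+1)%N by rewrite addnS addnC.
rewrite gE exprD; apply: dvdp_mul; first exact: sP.
have {}fn : ((size f).-1 %| n)%N by rewrite fa.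
apply: (dvdp_trans (irreducible_dvd_Xq1 f_irr f_mon f0 fn)).
by rewrite -[X in X %| _]expr1; apply: dvdp_exp2l.
Qed.

(** The exponent of [dvd_Xq1_exp] is raised to a power of the characteristic, which distributes over
    the difference. *)
Lemma dvd_Xq1_Xpow g : prime #|K| -> ~~ root g 0 -> exists s : seq nat,
  [/\ all (leq 1) s, sumn s = (size g).-1
    & forall n e, (lcm_seq s %| n)%N -> ((size g).-1 <= #|K| ^ e)%N ->
        g %| 'X^((#|K| ^ n - 1) * #|K| ^ e) - 1].
Proof.
move=> K_prime /dvd_Xq1_exp[s [s1 s_sum sP]]; exists s; split=> // n e /sP gX le_e.
apply: dvdp_trans gX _; apply: (dvdp_trans (dvdp_exp2l _ le_e)).
suff -> : ('X^(#|K| ^ n - 1) - 1 : {poly K}) ^+ (#|K| ^ e) =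
    'X^((#|K| ^ n - 1) * #|K| ^ e) - 1 by [].
have Kp : [pchar {poly K}].-nat (#|K| ^ e)%N.
  by rewrite pnatX pnatE // pchar_poly (@card_finPcharP _ _ 1) ?expn1.
by rewrite exprDn_pchar // exprNn_pchar // expr1n -exprM.
Qed.
End FiniteField.

(** * Sections of univariate rational series in characteristic p *)

Section Periodicity.
Variables (R : comNzRingType) (p : nat).
Hypothesis p_prime : prime p.
Hypothesis R_lift : frob_lift p (@idfun R).
Hypothesis R_char : p%:R = 0 :> R.
Implicit Types t g a b : fps R.

Lemma fps_frob_char g : g ^+ p = fps_frob p idfun g.
Proof.
have [e ->] := fps_frob_lift (phi := idfun) p_prime R_lift g.
rewrite (_ : e *+ p = 0) ?addr0 //.
by apply: fps_ext => n; rewrite coef_fpsMn -mulr_natr R_char mulr0.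
Qed.

Definition sectq (q t : fps R) : fps R := sect1 p 0 (t * q ^+ (p - 1)).

(* The transition [t / q |-> section of t / q] for [q = y^s g] and [a = t / g]. *)
Lemma iter_sectq s g a e : let k := (p ^ e)%N in
  iter e (sectq (fps_mono 1 s * g)) (g * a) =
  g * Fps (fun n => if (s * (k - 1) <= k * n)%N then a (k * n - s * (k - 1))%N else 0).
Proof.
have p_gt1 := prime_gt1 p_prime; have p_gt0 := prime_gt0 p_prime.
elim: e => [|e IHe] /=.
  by congr (g * _); apply: fps_ext => n; rewrite /= subnn muln0 subn0 mul1n.
rewrite IHe; set b := Fps _.
rewrite /sectq exprMn fps_mono_exp expr1n.
have -> : g * b * (fps_mono 1 (s * (p - 1))%N * g ^+ (p - 1)) =
    fps_mono 1 (s * (p - 1))%N * b * fps_frob p idfun g.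
  rewrite -fps_frob_char (_ : g ^+ p = g ^+ (p - 1) * g); first by ring.
  by rewrite -exprSr subn1 prednK.
rewrite sect1_frob // mulrC; congr (g * _); apply: fps_ext => n.
rewrite -[LHS]/((fps_mono 1 (s * (p - 1))%N * b) (p * n + 0)%N) coef_monoM mul1r addn0.
rewrite /b /= expnS.
have k_gt0 : (0 < p ^ e)%N by rewrite expn_gt0 p_gt0.
move: (p ^ e)%N k_gt0 => k k_gt0; case: leqP => [le_s|lt_s].
  have -> : (s * (k - 1) <= k * (p * n - s * (p - 1)))%N = (s * (p * k - 1) <= p * k * n)%N.
    by apply/idP/idP; nia.
  by case: ifP => // le_s'; congr (a _); nia.
by rewrite ifN // -ltnNge; nia.
Qed.

(** (x^E - 1) t/g equals t K, which vanishes in degrees above hi + E - dg. *)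
Lemma coef_periodic t V (E dg hi n : nat) (K : fps R) g :
  g * V = 1 -> g * K = fps_mono 1 E - 1 ->
  (forall i, t i != 0 -> (i <= hi)%N) -> (forall i, K i != 0 -> (i + dg <= E)%N) ->
  (hi < n + dg)%N -> (t * V) (n + E)%N = (t * V) n.
Proof.
move=> gV gK t_hi K_hi lt_n; have aE : t * V * (fps_mono 1 E - 1) = t * K.
  by rewrite -gK -[in RHS](mulr1 t) -gV; ring.
have : (t * V * (fps_mono 1 E - 1)) (n + E)%N = 0.
  rewrite aE coef_fpsM big1 // => i _; apply: contrapT => /eqP tK.
  have /t_hi : t i != 0 by apply: contraNneq tK => ->; rewrite mul0r.
  have /K_hi : K (n + E - i)%N != 0 by apply: contraNneq tK => ->; rewrite mulr0.
  by have := ltn_ord i; lia.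
rewrite mulrBr mulr1 mulrC -[LHS]/((fps_mono 1 E * (t * V)) (n + E)%N - (t * V) (n + E)%N).
rewrite coef_monoM leq_addl mul1r addnK => /eqP; rewrite subr_eq0 => /eqP //.
Qed.

(** Put a = t/g. After e steps the coefficient s + c reads a at index k c + s, and l more steps add
    (p^l - 1) k c, a multiple of the period of a. For c > 0 the index is past the preperiod, for c =
    0 it is s both times; coefficients below s can only read a below [lo], where it vanishes. *)
Lemma iter_sectq_periodic s g t V K lo hi dg l e : let k := (p ^ e)%N in
  g * V = 1 -> g * K = fps_mono 1 ((p ^ l - 1) * k)%N - 1 ->
  (forall i, t i != 0 -> (lo <= i <= hi)%N) ->
  (forall i, K i != 0 -> (i + dg <= (p ^ l - 1) * k)%N) ->
  (s < lo + k)%N -> (hi < s + dg + k)%N ->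
  iter (e + l) (sectq (fps_mono 1 s * g)) t = iter e (sectq (fps_mono 1 s * g)) t.
Proof.
move=> k gV gK t_supp K_hi s_lo hi_s; have [a aE] : exists a, a = t * V by exists (t * V).
have p_gt0 := prime_gt0 p_prime.
have -> : t = g * a by rewrite aE mulrCA gV mulr1.
rewrite !iter_sectq expnD -/k; congr (g * _); apply: fps_ext => n /=.
have k_gt0 : (0 < k)%N by rewrite expn_gt0 p_gt0.
have l_gt0 : (0 < p ^ l)%N by rewrite expn_gt0 p_gt0.
have a_lo i : (i < lo)%N -> a i = 0.
  move=> lt_i; rewrite aE coef_fpsM big1 // => j _.
  have [->|/t_supp] := eqVneq (t j) 0; first by rewrite mul0r.
  by have := ltn_ord j; lia.
have aP i m : (hi < i + dg)%N -> a (i + (p ^ l - 1) * k * m)%N = a i.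
  move=> hi_i; elim: m => [|m IHm]; first by rewrite muln0 addn0.
  rewrite mulnSr addnA -[RHS]IHm aE.
  apply: (coef_periodic gV gK (hi := hi) _ K_hi); last first.
    by rewrite addnAC (leq_trans hi_i) // leq_addr.
  by move=> j /t_supp /andP[].
move: (p ^ l)%N l_gt0 aP {gK K_hi} => q q_gt0 aP.
have [lt_ns|/subnKC <-] := ltnP n s.
  have small r : (0 < r)%N -> (if (s * (k * r - 1) <= k * r * n)%N
      then a (k * r * n - s * (k * r - 1))%N else 0) = 0.
    move=> r_gt0; case: ifP => // le; rewrite a_lo //; move: le.
    have le_k : (k <= k * r)%N by rewrite leq_pmulr.
    have : (k * r * n + k * r <= k * r * s)%N by rewrite -mulnSr leq_mul2l lt_ns orbT.
    have : (s <= k * r * s)%N by rewrite leq_pmull // muln_gt0 k_gt0.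
    by rewrite mulnBr muln1 [(s * _)%N]mulnC; lia.
  by rewrite small //; have := small 1%N; rewrite muln1 => ->.
move: (n - s)%N => c.
have le_s m : (s * (m - 1) <= m * (s + c))%N.
  by rewrite mulnC leq_mul ?leq_subr ?leq_addr.
have E m : (0 < m)%N -> (m * (s + c) - s * (m - 1) = m * c + s)%N.
  move=> m_gt0; have : (s <= s * m)%N by rewrite leq_pmulr.
  by rewrite mulnDr mulnBr muln1 [(m * s)%N]mulnC; lia.
rewrite !le_s !E ?muln_gt0 ?k_gt0 //.
have [->|c_gt0] := posnP c; first by rewrite !muln0.
rewrite -(aP (k * c + s)%N c).
  congr (a _); rewrite addnAC -mulnDl -{2}[k]mul1n -mulnDl subnKC //.
  by rewrite [(k * q)%N]mulnC.
have : (k <= k * c)%N by rewrite leq_pmulr.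
lia.
Qed.
End Periodicity.

Lemma fps_of_polyM (R : comNzRingType) (f g : {poly R}) :
  fps_of_poly (f * g) = fps_of_poly f * fps_of_poly g.
Proof. by apply: fps_ext => n; rewrite /= coefM. Qed.

Lemma fps_of_polyXn (R : comNzRingType) n : fps_of_poly ('X^n : {poly R}) = fps_mono 1 n.
Proof. by apply: fps_ext => i; rewrite /= coefXn; case: eqP. Qed.

(** Write q = X^s g with g(0) nonzero. From v <= s the degree of g is at most deg q - v, and M < p^e
    gives both deg g <= p^e and s < lo + p^e. *)
Lemma border_periodic_field (K : finFieldType) p (q : {poly K}) (t : fps K) lo hi v M :
  prime p -> #|K| = p -> q != 0 -> (forall n, q`_n != 0 -> (v <= n)%N) ->
  (forall i, t i != 0 -> (lo <= i <= hi)%N) ->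
  ((size q).-1 <= lo + M)%N -> ((size q).-1 <= v + M)%N ->
  exists s : seq nat, [/\ all (leq 1) s, (sumn s <= (size q).-1 - v)%N
    & forall l e, (lcm_seq s %| l)%N -> (M < p ^ e)%N -> (hi < (size q).-1 + p ^ e)%N ->
        iter (e + l) (sectq p (fps_of_poly q)) t = iter e (sectq p (fps_of_poly q)) t].
Proof.
move=> p_prime Kp q0 q_v t_supp q_lo q_vM.
have K_lift : frob_lift p (@idfun K).
  by move=> a; exists 0; rewrite -Kp expf_card mul0rn addr0.
have K_char : p%:R = 0 :> K.
  by have := @card_finPcharP K p 1; rewrite expn1 => /(_ Kp p_prime) /pcharf0.
have [s [g g0 qE]] := multiplicity_XsubC q 0.
rewrite q0 /= in g0; rewrite subr0 mulrC in qE.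
have gn0 : g != 0 by apply: contraNneq g0 => ->; rewrite root0.
have g00 : g`_0 != 0 by rewrite -horner_coef0.
have sz_q : (size q).-1 = (s + (size g).-1)%N.
  have X0 : 'X^s != 0 :> {poly K} by rewrite monic_neq0 ?monicXn.
  rewrite qE size_mul // size_polyXn addSn /=.
  by case: (size g) (size_poly_gt0 g) => [|k _]; rewrite ?gn0 // addnS.
have v_s : (v <= s)%N by apply: q_v; rewrite qE coefXnM ltnn subnn.
have [|sigma [sigma1 sigma_sum sigmaP]] := dvd_Xq1_Xpow _ g0; first by rewrite Kp.
exists sigma; split=> // [|l e]; first by rewrite sigma_sum sz_q -addnBAC // leq_addl.
move=> /sigmaP; rewrite Kp => gX M_e hi_e.
have [f fE] : exists f : {poly K}, 'X^((p ^ l - 1) * p ^ e) - 1 = f * g.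
  apply/dvdpP/gX/(leq_trans _ (ltnW M_e)).
  by rewrite -(leq_add2l v) (leq_trans _ q_vM) // sz_q leq_add2r.
have [V gV] := @fps_inv_exists _ (fps_of_poly g) (g`_0)^-1 (mulfV g00).
rewrite qE fps_of_polyM fps_of_polyXn.
apply: (@iter_sectq_periodic _ _ p_prime K_lift K_char
  _ _ _ V (fps_of_poly f) lo hi (size g).-1) => //.
- rewrite -fps_of_polyM mulrC -fE; apply: fps_ext => n.
  by rewrite /= coefB coefXn coef1; case: eqP.
- move=> i /= fi; have f0 : f != 0 by apply: contraNneq fi => ->; rewrite coef0.
  have lt_i : (i < size f)%N by rewrite ltnNge; apply: contra fi => le; rewrite nth_default.
  have : (size (f * g)%R <= ((p ^ l - 1) * p ^ e).+1)%N.
    by rewrite -fE (leq_trans (size_polyD _ _)) // size_polyN size_poly1 size_polyXn.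
  rewrite size_mul // => le_E; rewrite -ltnS; apply: leq_trans le_E.
  by case: (size g) (size_poly_gt0 g) => [|k _]; rewrite ?gn0 // addnS ltn_add2r.
- rewrite (leq_ltn_trans _ (_ : lo + M < _)%N) ?ltn_add2l //.
  by rewrite (leq_trans _ q_lo) // sz_q leq_addr.
- by rewrite -sz_q.
Qed.

(** Stated over any ring, so that the orbit of zeros can be studied over ['Z_(p ^ 1)] while the
    field structure enters only through [border_periodic_Zp]. *)
Definition border_periodic (R : comNzRingType) (p : nat) : Prop :=
  forall (q : {poly R}) (t : fps R) lo hi v M,
  q != 0 -> (forall n, q`_n != 0 -> (v <= n)%N) ->
  (forall i, t i != 0 -> (lo <= i <= hi)%N) ->
  ((size q).-1 <= lo + M)%N -> ((size q).-1 <= v + M)%N ->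
  exists s : seq nat, [/\ all (leq 1) s, (sumn s <= (size q).-1 - v)%N
    & forall l e, (lcm_seq s %| l)%N -> (M < p ^ e)%N -> (hi < (size q).-1 + p ^ e)%N ->
        iter (e + l) (sectq p (fps_of_poly q)) t = iter e (sectq p (fps_of_poly q)) t].

Lemma border_periodic_Zp p : prime p -> border_periodic 'Z_(p ^ 1) p.
Proof.
move=> p_prime; have -> : (p ^ 1)%N = pdiv p by rewrite expn1 pdiv_id.
move=> q t lo hi v M; apply: (@border_periodic_field 'F_p) => //.
exact: card_Fp.
Qed.

Lemma landau3_ge s1 s2 s3 l m n : (0 < l)%N -> (0 < m)%N -> (0 < n)%N ->
  all (leq 1) s1 -> all (leq 1) s2 -> all (leq 1) s3 ->
  (sumn s1 <= l)%N -> (sumn s2 <= m)%N -> (sumn s3 <= n)%N ->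
  (lcmn (lcmn (lcm_seq s1) (lcm_seq s2)) (lcm_seq s3) <= landau3 l m n)%N.
Proof.
have partP s k : (0 < k)%N -> all (leq 1) s -> (sumn s <= k)%N ->
    exists i s', [/\ i \in index_iota 1 k.+1, s' \in partitions i & lcm_seq s = lcm_seq s'].
  move=> k_gt0 all_s s_k; have [s0|s_gt0] := posnP (sumn s).
    (* The maximum runs over partitions of positive integers, so the empty list is replaced by a
       list with the same lcm. *)
    exists 1%N, [:: 1%N]; rewrite mem_partitions mem_index_iota; split=> //.
    by case: s all_s s0 {s_k} => [|[|a] s] //; rewrite /lcm_seq big_nil big_seq1.
  exists (sumn s), (sort geq s); rewrite mem_partitions mem_index_iota ltnS s_gt0 s_k.
  split=> //; last by apply: perm_big; rewrite perm_sym perm_sort.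
  apply/and3P; split; first by apply: sort_sorted => a b; apply: leq_total.
    by rewrite all_sort.
  by rewrite (perm_sumn (s2 := s)) ?perm_sort.
move=> l0 m0 n0 s1P s2P s3P s1l s2m s3n.
have [i1 [t1 [i1l t1i ->]]] := partP _ _ l0 s1P s1l.
have [i2 [t2 [i2m t2i ->]]] := partP _ _ m0 s2P s2m.
have [i3 [t3 [i3n t3i ->]]] := partP _ _ n0 s3P s3n.
rewrite /landau3.
apply: leq_trans (leq_bigmax_seq _ i1l isT).
apply: leq_trans (leq_bigmax_seq _ i2m isT).
apply: leq_trans (leq_bigmax_seq _ i3n isT).
apply: leq_trans (leq_bigmax_seq _ t1i isT).
apply: leq_trans (leq_bigmax_seq _ t2i isT).
by apply: leq_trans (leq_bigmax_seq _ t3i isT).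
Qed.

(** * The orbit of zeros modulo p *)

Section Faces.
Variable R : comNzRingType.
Implicit Types f g : fps (fps R).

Lemma coef_bfps1 i j : (1 : fps (fps R)) j i = ((i == 0%N) && (j == 0%N))%:R.
Proof.
rewrite coef_fps1; case: j => [|j]; last by rewrite andbF.
by rewrite [(0 == 0)%N]eqxx andbT -[RHS]coef_fps1.
Qed.

(** In x = XY, y = Y these are the columns x^0 and x^A, indexed by the exponent of Y, and the row
    y^C, indexed by that of X. *)
Definition left_face f : fps R := Fps (fun j => f j 0%N).
Definition right_face A f : fps R := Fps (fun j => f j A).
Definition top_face C f : fps R := Fps (fun i => f (i + C)%N i).

Lemma left_faceM f g : left_face (f * g) = left_face f * left_face g.
Proof.
apply: fps_ext => j; rewrite [LHS]coef_bfpsM coef_fpsM.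
by apply: eq_bigr => l _; rewrite big_ord1.
Qed.

Lemma right_faceM A A' f g : supp2 (fun i j => i <= A)%N f ->
  supp2 (fun i j => i <= A')%N g ->
  right_face (A + A') (f * g) = right_face A f * right_face A' g.
Proof.
move=> fA gA; apply: fps_ext => j; rewrite [LHS]coef_bfpsM coef_fpsM.
apply: eq_bigr => l _; have lt_A : (A < (A + A').+1)%N by rewrite ltnS leq_addr.
rewrite (bigD1 (Ordinal lt_A)) //= addKn big1 ?addr0 // => k.
rewrite -val_eqE /= => ne_k; apply: contrapT => /eqP fg; case/eqP: ne_k.
have /fA : f l k != 0 by apply: contraNneq fg => ->; rewrite mul0r.
have /gA : g (j - l)%N (A + A' - k)%N != 0 by apply: contraNneq fg => ->; rewrite mulr0.
by have := ltn_ord k; lia.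
Qed.

Lemma top_faceM C C' f g : supp2 (fun i j => j <= i + C)%N f ->
  supp2 (fun i j => j <= i + C')%N g ->
  top_face (C + C') (f * g) = top_face C f * top_face C' g.
Proof.
move=> fC gC; apply: fps_ext => i; rewrite [LHS]coef_bfpsM coef_fpsM exchange_big /=.
apply: eq_bigr => k _; have le_k := leq_ord k.
have lt_l : (k + C < (i + (C + C')).+1)%N by lia.
rewrite (bigD1 (Ordinal lt_l)) //= big1 ?addr0 => [|l].
  by congr (_ * g _ _); lia.
rewrite -val_eqE /= => ne_l; apply: contrapT => /eqP fg; case/eqP: ne_l.
have /fC : f l k != 0 by apply: contraNneq fg => ->; rewrite mul0r.
have /gC : g (i + (C + C') - l)%N (i - k)%N != 0.
  by apply: contraNneq fg => ->; rewrite mulr0.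
by have := ltn_ord l; lia.
Qed.

Lemma left_face_exp f n : left_face (f ^+ n) = left_face f ^+ n.
Proof.
elim: n => [|n IHn]; last by rewrite !exprS left_faceM IHn.
by apply: fps_ext => j; rewrite !expr0 [LHS]coef_bfps1 coef_fps1.
Qed.

Lemma right_face_exp A f n : supp2 (fun i j => i <= A)%N f ->
  right_face (n * A) (f ^+ n) = right_face A f ^+ n.
Proof.
move=> fA; elim: n => [|n IHn]; last first.
  rewrite !exprS mulSn right_faceM ?IHn //.
  elim: n {IHn} => [|n IHn]; first by rewrite expr0; apply: supp2_1.
  by rewrite exprS mulSn; apply: supp2M fA IHn => i _ k _; apply: leq_add.
by apply: fps_ext => j; rewrite !expr0 [LHS]coef_bfps1 coef_fps1.
Qed.

Lemma top_face_exp C f n : supp2 (fun i j => j <= i + C)%N f ->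
  top_face (n * C) (f ^+ n) = top_face C f ^+ n.
Proof.
move=> fC; elim: n => [|n IHn]; last first.
  rewrite !exprS mulSn top_faceM ?IHn //.
  elim: n {IHn} => [|n IHn]; first by rewrite expr0; apply: supp2_1.
  by rewrite exprS mulSn; apply: supp2M fC IHn => i j k l; lia.
by apply: fps_ext => i; rewrite !expr0 [LHS]coef_bfps1 coef_fps1 addn0 andbb.
Qed.
End Faces.

Section ZeroOrbit.
Variables (R : comNzRingType) (p h D : nat) (Q U : fps (fps R)).
Hypothesis p_prime : prime p.
Hypothesis R_lift : frob_lift p (@idfun R).
Hypothesis R_char : p%:R = 0 :> R.
Hypothesis Q_box : supp2 (box h 1 D) Q.
Hypothesis QU : Q * U = 1.
Hypothesis h_gt0 : (0 < h)%N.
Implicit Types (T : fps (fps R)) (w : seq 'I_p).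

Definition num_sect r T := sect2 p r (T * Q ^+ (p - 1)).

(** In characteristic p, U^p is the Frobenius twist of U, so T/Q = T Q^(p-1)/Q^p and the denominator
    leaves the section as Q. *)
Lemma sect2_num r T : (r < p)%N -> sect2 p r (T * U) = num_sect r T * U.
Proof.
move=> lt_rp; have p_gt0 := prime_gt0 p_prime.
have [E _ UpE] := frob_inverse Q_box QU p_prime R_lift.
have UpF : U ^+ p = frob2 p U.
  rewrite UpE (_ : _ *+ p = 0) ?subr0 //.
  by apply: bfps_ext => i j; rewrite coef_bfpsMn -mulr_natr R_char mulr0.
rewrite -sect2_frob // -UpF -mulrA; congr (sect2 p r (T * _)).
by rewrite -{2}(subnK p_gt0) exprD expr1 mulrA -exprMn QU expr1n mul1r.
Qed.

Lemma num_sect_box A r T : (r < p)%N -> supp2 (box A 0 D) T ->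
  supp2 (box ((A + (p - 1) * h) %/ p) 0 D) (num_sect r T).
Proof.
move=> lt_rp Tb; have p_gt0 := prime_gt0 p_prime.
have := box_sect2 (r := r) p_gt0 (boxM Tb (box_exp (n := (p - 1)%N) Q_box)).
apply: box_le => //.
  by rewrite add0n muln1 divn_small //; lia.
by rewrite -{1}[D]mul1n -mulnDl subnKC // mulKn.
Qed.

Lemma num_sect_box_h r T : (r < p)%N -> supp2 (box h 0 D) T ->
  supp2 (box h 0 D) (num_sect r T).
Proof.
move=> lt_rp /(num_sect_box lt_rp).
by rewrite -{1}[h]mul1n -mulnDl subnKC ?mulKn ?prime_gt0.
Qed.

Lemma num_sect_box_pred r T : (r < p)%N -> supp2 (box h.-1 0 D) T ->
  supp2 (box h.-1 0 D) (num_sect r T).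
Proof.
move=> lt_rp /(num_sect_box lt_rp); have p_gt0 := prime_gt0 p_prime.
apply: box_le => //; rewrite -ltnS prednK // ltn_divLR //.
by case: p p_gt0 => // k _; rewrite subn1 mulnS [(h * k)%N]mulnC ltn_add2r prednK.
Qed.

(** A coefficient of index i comes from the exponent p i + r of X, which is at most p h; for r > 0
    this forces i < h. *)
Lemma num_sect_drop r T : (0 < r < p)%N -> supp2 (box h 0 D) T ->
  supp2 (box h.-1 0 D) (num_sect r T).
Proof.
case/andP=> r_gt0 lt_rp Tb i j; have p_gt0 := prime_gt0 p_prime.
move=> Tij; have /and3P[_ iB jC] := num_sect_box_h lt_rp Tb Tij.
rewrite /box iB jC !andbT; move: Tij => /=.
have := boxM Tb (box_exp (n := (p - 1)%N) Q_box).
move=> TQb /TQb /and3P[iA _ _]; rewrite -ltnS prednK //.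
move: iA; rewrite -{1}[h]mul1n -mulnDl subnKC // => iA.
by rewrite -(ltn_pmul2l p_gt0); lia.
Qed.

Definition orbit_num T e := iter e (num_sect 0) T.

Lemma orbit_num_box T e : supp2 (box h 0 D) T -> supp2 (box h 0 D) (orbit_num T e).
Proof. by move=> Tb; elim: e => //= e IHe; apply: num_sect_box_h; rewrite ?prime_gt0. Qed.

Lemma kernel_num T w : supp2 (box h 0 D) T ->
  sect2w (T * U) w = orbit_num T (size w) * U \/
  exists2 T', supp2 (box h.-1 0 D) T' & sect2w (T * U) w = T' * U.
Proof.
move=> Tb; elim/last_ind: w => [|w r IHw]; first by left.
rewrite /sect2w foldl_rcons -/(sect2w _ w) size_rcons /=.
case: IHw => [->|[T' T'b ->]]; rewrite sect2_num //; last first.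
  by right; exists (num_sect r T') => //; apply: num_sect_box_pred.
have [r0|r_gt0] := posnP r; first by left; rewrite r0.
right; exists (num_sect r (orbit_num T (size w))) => //.
by apply: num_sect_drop; [rewrite r_gt0 /=|apply: orbit_num_box].
Qed.

Lemma left_orbit T e : left_face (orbit_num T e) =
  iter e (sectq p (left_face Q)) (left_face T).
Proof.
elim: e => //= e IHe; rewrite -IHe /sectq -left_face_exp -left_faceM.
by apply: fps_ext => j; rewrite /= !addn0 muln0.
Qed.

Lemma right_orbit T e : supp2 (box h 0 D) T -> right_face h (orbit_num T e) =
  iter e (sectq p (right_face h Q)) (right_face h T).
Proof.
move=> Tb; have p_gt0 := prime_gt0 p_prime; elim: e => //= e IHe.
have Q_x : supp2 (fun i j => i <= h)%N Q by apply: supp2_sub Q_box => i j /and3P[].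
rewrite -IHe /sectq -(right_face_exp _ Q_x) -right_faceM.
- have -> : (h + (p - 1) * h)%N = (p * h)%N by rewrite -{1}[h]mul1n -mulnDl subnKC.
  by apply: fps_ext => j; rewrite /= !addn0.
- by apply: supp2_sub (orbit_num_box (e := e) Tb) => i j /and3P[].
- by apply: supp2_sub (box_exp (n := (p - 1)%N) Q_box) => i j /and3P[].
Qed.

Lemma top_orbit T e : supp2 (box h 0 D) T -> top_face D (orbit_num T e) =
  iter e (sectq p (top_face D Q)) (top_face D T).
Proof.
move=> Tb; have p_gt0 := prime_gt0 p_prime; elim: e => //= e IHe.
have Q_y : supp2 (fun i j => j <= i + D)%N Q by apply: supp2_sub Q_box => i j /and3P[].
rewrite -IHe /sectq -(top_face_exp _ Q_y) -top_faceM.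
- have -> : (D + (p - 1) * D)%N = (p * D)%N by rewrite -{1}[D]mul1n -mulnDl subnKC.
  by apply: fps_ext => j; rewrite /= !addn0 mulnDr.
- by apply: supp2_sub (orbit_num_box (e := e) Tb) => i j /and3P[].
- by apply: supp2_sub (box_exp (n := (p - 1)%N) Q_box) => i j /and3P[].
Qed.

(** The row y^0 is kept, so that (h - 1) D positions remain. *)
Definition inner_supp i j := [&& 0 < i, i < h, i <= j & j < i + D]%N.

Lemma inner_of_faces T T' : supp2 (box h 0 D) T -> supp2 (box h 0 D) T' ->
  left_face T = left_face T' -> right_face h T = right_face h T' ->
  top_face D T = top_face D T' -> supp2 inner_supp (T - T').
Proof.
move=> Tb T'b eql eqr eqt i j; have /(_ i j) := supp2B Tb T'b.
rewrite -[(T - T') j i]/(T j i - T' j i) subr_eq0 => TT' neq.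
have /and3P[iA iB jC] := TT' neq; rewrite addn0 in iB.
rewrite /inner_supp iB !ltn_neqAle iA jC !andbT eq_sym; apply/and3P; split.
- apply: contra neq => /eqP ->; apply/eqP.
  exact: (congr1 (fun f : fps R => f j) eql).
- apply: contra neq => /eqP ->; apply/eqP.
  exact: (congr1 (fun f : fps R => f j) eqr).
- apply: contra neq => /eqP ->; apply/eqP.
  exact: (congr1 (fun f : fps R => f i) eqt).
Qed.
End ZeroOrbit.

(** Cutting q at [top] loses nothing and gives a polynomial; its nonzero coefficient of index [n]
    bounds the degree from below, as the condition on [hi] requires. *)
Lemma face_periodic (R : comNzRingType) p (q t : fps R) lo hi v top n m M :
  border_periodic R p -> q n != 0 ->
  (forall i, q i != 0 -> (v <= i <= top)%N) ->
  (forall i, t i != 0 -> (lo <= i <= hi)%N) ->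
  (top <= lo + M)%N -> (top <= v + M)%N -> (M < p ^ m)%N -> (hi < n + p ^ m)%N ->
  (0 < p)%N ->
  exists s : seq nat, [/\ all (leq 1) s, (sumn s <= top - v)%N
    & forall l e, (lcm_seq s %| l)%N -> (m <= e)%N ->
        iter (e + l) (sectq p q) t = iter e (sectq p q) t].
Proof.
move=> per qn q_supp t_supp top_lo top_v M_m hi_n p_gt0.
pose Q := fps_trunc top q.
have qE : q = fps_of_poly Q.
  apply: fps_ext => i; rewrite /= coef_poly; case: ifP => // /negbT lt_i.
  by apply/eqP; apply: contraNT lt_i => /q_supp; rewrite ltnS => /andP[].
have QE i : Q`_i = q i by rewrite qE.
have Q0 : Q != 0 by apply: contraNneq qn => Q0; rewrite qE Q0 /= coef0.
have sz_Q : ((size Q).-1 <= top)%N.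
  by rewrite -subn1 leq_subLR add1n; apply: size_poly.
have n_Q : (n <= (size Q).-1)%N.
  rewrite -ltnS prednK ?size_poly_gt0 // ltnNge; apply: contra qn => le.
  by rewrite -QE nth_default.
have [|||s [s1 s_sum sP]] := per Q t lo hi v M Q0 _ t_supp.
- by move=> i; rewrite QE => /q_supp /andP[].
- exact: leq_trans top_lo.
- exact: leq_trans top_v.
exists s; split=> // [|l e s_l m_e]; first by apply: leq_trans s_sum _; rewrite leq_sub2r.
have le_e : (p ^ m <= p ^ e)%N by rewrite leq_pexp2l.
rewrite qE; apply: sP => //; first exact: leq_trans le_e.
by apply: leq_trans hi_n _; rewrite leq_add.
Qed.

Section ZeroOrbitCount.
Variables (R : comNzRingType) (p h D : nat) (Q U : fps (fps R)).
Variable digits : seq R.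
Hypothesis digitsP : digits_mod p digits.
Hypothesis p_prime : prime p.
Hypothesis R_lift : frob_lift p (@idfun R).
Hypothesis R_char : p%:R = 0 :> R.
Hypothesis Q_box : supp2 (box h 1 D) Q.
Hypothesis QU : Q * U = 1.
Hypothesis h_gt0 : (0 < h)%N.
Hypothesis per : border_periodic R p.
Implicit Types (T : fps (fps R)) (w : seq 'I_p).

(** The exponents of the left, right and top faces of [Q] range over 0..D, h-1..h+D and 0..h, so the
    degree lists sum to at most D, D+1 and h. The lcm of the three periods serves all faces. *)
Lemma orbit_num_periodic T m dl dr dt : supp2 (box h 0 D) T ->
  Q dl 0%N != 0 -> Q dr h != 0 -> Q (dt + D)%N dt != 0 ->
  (D < dl + p ^ m)%N -> (h + D < dr + p ^ m)%N -> (h < dt + p ^ m)%N ->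
  (h < p ^ m)%N -> (D.+1 < p ^ m)%N ->
  exists l, [/\ (0 < l)%N, (l <= landau3 h D.+1 D.+1)%N
    & forall e, (m <= e)%N ->
        supp2 (inner_supp h D) (orbit_num p Q T (e + l) - orbit_num p Q T e)].
Proof.
move=> Tb Ql Qr Qt l_m r_m t_m h_m D_m; have p_gt0 := prime_gt0 p_prime.
have [|||||||sl [sl1 sl_sum slP]] := @face_periodic _ p (left_face Q) (left_face T)
  0 D 0 D dl m D per Ql; rewrite ?add0n ?subn0 //.
- by move=> j /Q_box /and3P[].
- by move=> j /Tb /and3P[].
- exact: ltnW.
have [|||||||sr [sr1 sr_sum srP]] := @face_periodic _ p (right_face h Q) (right_face h T)
  h (h + D) h.-1 (h + D) dr m D.+1 per Qr; rewrite ?leq_add2l //.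
- by move=> j /Q_box /and3P[_ hj ->]; rewrite andbT; lia.
- by move=> j /Tb /and3P[_ hj ->]; rewrite andbT; lia.
- by lia.
have [|||||||st [st1 st_sum stP]] := @face_periodic _ p (top_face D Q) (top_face D T)
  0 h 0 h dt m h per Qt; rewrite ?add0n ?subn0 //.
- by move=> j /Q_box /and3P[].
- by move=> j /Tb /and3P[].
exists (lcmn (lcmn (lcm_seq st) (lcm_seq sl)) (lcm_seq sr)).
have lcm_gt0 s : all (leq 1) s -> (0 < lcm_seq s)%N.
  elim: s => [|a s IHs]; rewrite /lcm_seq ?big_nil //= big_cons lcmn_gt0.
  by case/andP=> -> /IHs.
split=> [||e m_e].
- by rewrite !lcmn_gt0 !lcm_gt0.
- rewrite subn0 in sl_sum; rewrite subn0 in st_sum.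
  apply: landau3_ge => //; first by lia.
  by lia.
apply: (inner_of_faces (h := h) (D := D)); try exact: (orbit_num_box p_prime Q_box h_gt0).
- rewrite !left_orbit; apply: slP => //.
  by apply: dvdn_trans (dvdn_lcml _ _); apply: dvdn_lcmr.
- rewrite !(right_orbit p_prime Q_box h_gt0) //; apply: srP => //; apply: dvdn_lcmr.
- rewrite !(top_orbit p_prime Q_box h_gt0) //; apply: stP => //.
  by apply: dvdn_trans (dvdn_lcml _ _); apply: dvdn_lcml.
Qed.

Definition rows (a b c : nat) : seq (nat * nat) :=
  [seq (i, i + k)%N | i <- iota a b, k <- iota 0 c].

Lemma size_rows a b c : size (rows a b c) = (b * c)%N.
Proof. by rewrite size_allpairs !size_iota. Qed.

Lemma mem_rows a b c i j :
  ((i, j) \in rows a b c) = [&& a <= i, i < a + b, i <= j & j < i + c]%N.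
Proof.
apply/allpairsP/idP => [[[i' k]] /=|].
  by rewrite !mem_iota => -[/andP[ai ib] kc [-> ->]]; lia.
case/and4P => ai ib ij jc; exists (i, (j - i)%N); rewrite /= !mem_iota.
by split; [rewrite ai|lia|rewrite subnKC].
Qed.

Lemma supp2_enum_char (pos : seq (nat * nat)) :
  exists L : seq (fps (fps R)), size L = (p ^ size pos)%N /\
    forall T, supp2 (fun i j => (i, j) \in pos) T -> T \in L.
Proof.
have [L [sz_L LP]] := supp2_enum digitsP pos; exists L; split=> // T.
case/LP => t [T' [tL _ ->]]; rewrite (_ : T' *+ p = 0) ?addr0 //.
by apply: bfps_ext => i j; rewrite coef_bfpsMn -mulr_natr R_char mulr0.
Qed.

(** Three kinds of states: after a nonzero digit, numerators with h columns of D + 1 entries; the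
    first [m] members of the orbit of zeros; later members, each differing from one of [l]
    representatives by an inner numerator. *)
Lemma orbit_kernel T m l : supp2 (box h 0 D) T -> (0 < l)%N ->
  (forall e, (m <= e)%N ->
    supp2 (inner_supp h D) (orbit_num p Q T (e + l) - orbit_num p Q T e)) ->
  exists L : seq (fps R), size L = (p ^ (h * D.+1) + m + p ^ (h.-1 * D) * l)%N /\
    forall w, sect1w (diag (T * U)) w \in L.
Proof.
move=> Tb l_gt0 T_per.
have [L1 [sz_L1 L1P]] := supp2_enum_char (rows 0 h D.+1).
have [L2 [sz_L2 L2P]] := supp2_enum_char (rows 1 h.-1 D).
pose S := [seq diag (T' * U) | T' <- L1 ++ [seq orbit_num p Q T e | e <- iota 0 m]
   ++ [seq orbit_num p Q T e + T' | T' <- L2, e <- iota m l]].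
exists S; split.
  rewrite size_map !size_cat size_allpairs size_map !size_iota.
  by rewrite sz_L1 sz_L2 !size_rows addnA.
have T_inner c k : (m <= c)%N ->
    supp2 (inner_supp h D) (orbit_num p Q T (c + k * l) - orbit_num p Q T c).
  move=> m_c; elim: k => [|k IHk]; first by rewrite addn0 subrr; apply: supp2_0.
  rewrite mulSn [(l + _)%N]addnC addnA.
  rewrite -[orbit_num _ _ _ (_ + l)%N](subrK (orbit_num p Q T (c + k * l))) -addrA.
  by apply: supp2D => //; apply: T_per; rewrite (leq_trans m_c) ?leq_addr.
move=> w; rewrite -diag_sect2w.
have [->|[T1 T1b ->]] := kernel_num p_prime R_lift R_char Q_box QU h_gt0 w Tb; last first.
  apply: map_f; rewrite mem_cat L1P //; apply: supp2_sub T1b => i j.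
  by rewrite mem_rows /box; lia.
apply: map_f; rewrite !mem_cat; have [lt_m|le_m] := ltnP (size w) m.
  by rewrite (map_f (orbit_num p Q T)) ?orbT // mem_iota.
apply/orP; right; apply/orP; right; apply/allpairsP.
pose c := (m + (size w - m) %% l)%N; pose k := ((size w - m) %/ l)%N.
have wE : size w = (c + k * l)%N.
  by rewrite /c -addnA [(_ %% _ + _)%N]addnC -divn_eq subnKC.
exists (orbit_num p Q T (size w) - orbit_num p Q T c, c).
split=> /=; last by rewrite addrC subrK.
  apply: L2P; rewrite wE; apply: supp2_sub (T_inner c k _) => [i j|]; last exact: leq_addr.
  by rewrite mem_rows /inner_supp; lia.
by rewrite mem_iota leq_addr ltn_add2l ltn_pmod.
Qed.
End ZeroOrbitCount.

(** * Initial state and counting *)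

Section InitialState.
Variables (R : comNzRingType) (p h D ex ey : nat) (Q U E G V : fps (fps R)).
Hypothesis Q_box : supp2 (box h 1 D) Q.
Hypothesis QU : Q * U = 1.
Hypothesis E_box : supp2 (box (h + ex) 1 (D + ey)) E.
Hypothesis GE : G = Q + E *+ p.
Hypothesis GV : G * V = 1.
Local Notation tbox := (tbox h D).
Local Notation level := (level p h D U).

Lemma inverse_perturb : V = U - (E * U * V) *+ p.
Proof.
have -> : (E * U * V) *+ p = U * (G * V) - V * (Q * U) by rewrite GE; ring.
by rewrite GV QU !mulr1 subKr.
Qed.

(** 1/G = 1/Q - p E/(QG) is substituted [a] times; each round gains a factor [p] and a factor [E],
    hence one more excess ex and ey. *)
Lemma level_inverse x y a m T : supp2 (tbox x y m) T ->
  level (x + a * ex) (y + a * ey) a m (T * U ^+ m * V).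
Proof.
elim: a x y m T => // a IHa x y m T Tb.
have -> : T * U ^+ m * V = T * U ^+ m.+1 - (T * E * U ^+ m.+1 * V) *+ p.
  by rewrite {1}inverse_perturb exprS; ring.
exists T, (- (T * E * U ^+ m.+1 * V)); split; last by rewrite mulNrn.
  by apply: box_le Tb; rewrite ?leq_add2l ?leq_addr.
apply: levelN; rewrite !mulSn !addnA; apply: IHa.
by apply: box_le (boxM Tb E_box) => //; rewrite ?mulSn; lia.
Qed.

(** The term A0 E meets [E] up to a + 1 times in all, and A1 has one more degree in y: these are the
    two quantities compared in the definition of u. *)
Lemma state_init a A A0 A1 : supp2 (box h 0 D) A0 ->
  supp2 (box (h + ex) 0 (D + ey).+1) A1 -> A = A0 + A1 *+ p ->
  state p h D U (a.+1 * ex) (a.+1 * ey).+1 a (A * V).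
Proof.
move=> A0b A1b ->; exists A0, (A1 * V - A0 * E * U * V); split.
- by apply: box_le A0b; rewrite ?mul1n ?addn0.
- apply: levelD.
    apply: (levelS Q_box QU); have := @level_inverse ex ey.+1 a 0 A1.
    rewrite expr0 mulr1 mulSn mulSn addSn; apply.
    by apply: box_le A1b; rewrite ?mul1n ?addnS.
  apply: levelN; have := @level_inverse ex ey a 1 (A0 * E); rewrite expr1 => lv.
  apply: level_le (lv _); rewrite -?mulSn //.
  by apply: box_le (boxM A0b E_box); rewrite ?mulSn ?mul0n; lia.
rewrite mulrDl {1}inverse_perturb; ring.
Qed.
End InitialState.

Definition tbox_pos h D m : seq (nat * nat) :=
  [seq (i, i - m + k)%N | i <- iota 0 (m.+1 * h).+1, k <- iota 0 (minn i m + m.+1 * D).+1].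

Lemma mem_tbox_pos h D m i j : ((i, j) \in tbox_pos h D m) = tbox h D 0 0 m i j.
Proof.
rewrite /tbox /box; apply/allpairsPdep/idP => [[i' [k]]|].
  by rewrite !mem_iota => -[i'_le k_le [-> ->]]; lia.
case/and3P => iA iB jC; exists i, (j - (i - m))%N; rewrite !mem_iota.
by split; [lia|lia|congr (_, _); lia].
Qed.

(** Each column has (m+1) d positions, except that m - i of them are lost for i < m because j >= 0;
    the total loss is m(m+1)/2. *)
Lemma size_tbox_pos h d m : (0 < h)%N -> (0 < d)%N ->
  (2 * size (tbox_pos h d.-1 m) + m * m.+1 = 2 * ((m.+1 * h + 1) * (m.+1 * d)))%N.
Proof.
move=> h_gt0 d_gt0; rewrite size_allpairs_dep.
have -> : [seq size (iota 0 (minn i m + m.+1 * d.-1).+1) | i <- iota 0 (m.+1 * h).+1] =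
    [seq (minn i m + m.+1 * d.-1).+1 | i <- iota 0 (m.+1 * h).+1].
  by apply: eq_map => i; rewrite size_iota.
have -> : (m.+1 * d = m.+1 + m.+1 * d.-1)%N by rewrite -mulnS prednK.
have m_le : (m <= m.+1 * h)%N by rewrite (leq_trans (leqnSn m)) // leq_pmulr.
move: (m.+1 * h)%N (m.+1 * d.-1)%N m_le => n c m_le.
pose S k := sumn [seq (minn i m + c).+1 | i <- iota 0 k]; rewrite -/(S n.+1).
have SS k : S k.+1 = (S k + (minn k m + c).+1)%N.
  rewrite /S (_ : iota 0 k.+1 = iota 0 k ++ [:: k]); last by rewrite -addn1 iotaD.
  by rewrite map_cat sumn_cat /= addn0.
have small k : (k <= m)%N -> (2 * S k + k = k * k + 2 * k * (c + 1))%N.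
  elim: k => // k IHk lt_km; rewrite SS (minn_idPl (ltnW lt_km)).
  by have := IHk (ltnW lt_km); lia.
have {m_le} [k ->] : exists k, n = (m + k)%N by exists (n - m)%N; rewrite subnKC.
elim: k => [|k IHk]; first by rewrite addn0 SS minnn; have := small m (leqnn m); lia.
have le_m : (m <= (m + k).+1)%N by lia.
by rewrite addnS SS (minn_idPr le_m); lia.
Qed.

(** The case h = d = 1 is excluded because for a = 1 the left side is then 5 and the right side
    4. *)
Lemma state_count_le a h d : (0 < a)%N -> (0 < h)%N -> (0 < d)%N ->
  (h != 1)%N || (d != 1)%N ->
  (size (tbox_pos h d.-1 0) + 1 + \sum_(i < a) size (tbox_pos h d.-1 i) <= expN a.+1 h d)%N.
Proof.
move=> a_gt0 h_gt0 d_gt0 hd1; rewrite -(leq_pmul2l (isT : 0 < 6)%N) expNE //.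
have [sz szE] : exists sz, forall i, size (tbox_pos h d.-1 i) = sz i.
  by exists (fun i => size (tbox_pos h d.-1 i)).
have szP i := size_tbox_pos i h_gt0 d_gt0; rewrite szE; under eq_bigr do rewrite szE.
have S_E : (6 * (\sum_(i < a) sz i) + a.-1 * a * a.+1 =
    h * d * (a * a.+1 * (2 * a + 1)) + 3 * d * (a * a.+1))%N.
  elim: a {a_gt0} => [|a IHa]; first by rewrite big_ord0; lia.
  rewrite big_ord_recr mulnDr; have := szP a; rewrite szE /=.
  by move: IHa; move: (\sum_(i < a) _)%N (sz a) => A B; case: a => [|a]; lia.
(* After substitution of [S_E] the claim is exactly three times [core]. *)
have core : ((a * a.+1 + 2) * (1 + d) <= 2 * (h * d) * (a * a + 2 * a))%N.
  have a_a : (a <= a * a)%N by rewrite leq_pmulr.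
  have [h1|h_gt1] := leqP h 1.
    have -> : h = 1%N by lia.
    have d_gt1 : (2 * (1 + d) <= 3 * d)%N by move: hd1; lia.
    have aX : (3 * (a * a.+1 + 2) <= 4 * (a * a + 2 * a))%N by lia.
    by have := leq_mul aX d_gt1; rewrite mul1n; lia.
  have aX : (a * a.+1 + 2 <= 2 * (a * a + 2 * a))%N by lia.
  have dd : (1 + d <= h * d)%N by apply: leq_trans (leq_mul h_gt1 (leqnn d)); lia.
  by have := leq_mul aX dd; lia.
have -> : sz 0%N = (h * d + d)%N by have := szP 0%N; rewrite szE; lia.
have hd0 : (0 < h * d)%N by rewrite muln_gt0 h_gt0.
rewrite -[(2 * h * d)%N]mulnA; move: core S_E; move: (\sum_(i < a) _)%N => A.
move: (h * d)%N hd0 => [//|c] _; have -> : (2 * c.+1 - 1 = 2 * c + 1)%N by lia.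
by case: a a_gt0 => // a _ /=; lia.
Qed.

Definition diag_pos m : seq (nat * nat) := [seq (i, i) | i <- iota 0 m.+2].

Lemma diag_pos_box m i j : (i, j) \in diag_pos m -> tbox 1 0 0 0 m i j.
Proof.
by case/mapP => k; rewrite mem_iota => k_m [-> ->]; rewrite /tbox /box; lia.
Qed.

Lemma diag_count_le a : (1 < a)%N ->
  (size (diag_pos 0) + 1 + \sum_(i < a) size (diag_pos i) <= expN a.+1 1 1)%N.
Proof.
move=> a_gt1; rewrite -(leq_pmul2l (isT : 0 < 6)%N) expNE //.
have S_E : (2 * \sum_(i < a) size (diag_pos i) = a * (a + 3))%N.
  under eq_bigr do rewrite size_map size_iota.
  elim: a {a_gt1} => [|a IHa]; first by rewrite big_ord0.
  by rewrite big_ord_recr /= mulnDr IHa; lia.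
move: S_E; move: (\sum_(i < a) _)%N => A S_E.
rewrite [size _]/= !muln1 (_ : (2 - 1 = 1)%N) // mul1n.
have : (2 * a <= a * a)%N by rewrite leq_mul2r a_gt1 orbT.
have : (2 * (a * a) <= a * a * a)%N by rewrite mulnC leq_mul2l a_gt1 orbT.
lia.
Qed.

(** * The case h = d = 1 *)

Section BidegreeOne.
Variables (R : comNzRingType) (Q U : fps (fps R)) (c : R).
Hypothesis Q_box : supp2 (box 1 1 0) Q.
Hypothesis QU : Q * U = 1.
Hypothesis Q00 : Q 0%N 0%N * c = 1.
Local Notation tbox := (tbox 1 0 0 0).

Lemma inverse_lower : supp2 (fun i j => (j <= i)%N) U.
Proof.
apply: (@supp2_inv _ _ Q U c) => //; first by move=> i j k l; lia.
by apply: supp2_sub Q_box => i j /and3P[_ _]; rewrite addn0.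
Qed.

Lemma inverse_exp_lower n : supp2 (fun i j => (j <= i)%N) (U ^+ n).
Proof.
elim: n => [|n IHn]; first by rewrite expr0; apply: supp2_1.
by rewrite exprS; apply: supp2M inverse_lower IHn => i j k l; lia.
Qed.

Lemma diag_pos_diag m T : supp2 (tbox m) T ->
  exists2 T1, supp2 (fun i j => (i, j) \in diag_pos m) T1 &
    diag (T * U ^+ m.+1) = diag (T1 * U ^+ m.+1).
Proof.
move=> Tb; pose T1 := restrict2 (fun i j => i == j) T; exists T1.
  move=> i j /=; case: (i =P j) => [-> /Tb|]; last by rewrite eqxx.
  rewrite /tbox /box => /and3P[j_m _ _].
  by apply/mapP; exists j; rewrite // mem_iota; lia.
rewrite -[T in LHS](subrK T1) mulrDl diagD.
rewrite (diag_supp0 (S := fun i j => (j < i)%N)) ?add0r //.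
  by move=> i; rewrite ltnn.
apply: (@supp2M _ (fun i j => (j < i)%N) (fun i j => (j <= i)%N)).
- by move=> i j k l; lia.
- move=> i j; rewrite -[(T - T1) j i]/(T j i - T1 j i) /=.
  case: (i =P j) => [_|ne]; first by rewrite subrr eqxx.
  by rewrite subr0 => /Tb /and3P[_ _]; lia.
- exact: inverse_exp_lower.
Qed.

Let mu := - (c * Q 1%N 1%N).

(** Diagonals are multiplicative on series supported in j <= i, so the diagonal of T/Q is a quotient
    of two polynomials of degree at most 1. *)
Lemma diag_recurrence T n : supp2 (tbox 0) T ->
  diag (T * U) n.+2 = mu * diag (T * U) n.+1.
Proof.
move=> Tb; have diagE (f : fps (fps R)) : diag f = top_face 0 f.
  by apply: fps_ext => i; rewrite /= addn0.
have Q_low : supp2 (fun i j => j <= i + 0)%N Q by apply: supp2_sub Q_box => i j /and3P[].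
have T_low : supp2 (fun i j => j <= i + 0)%N T by apply: supp2_sub Tb => i j /and3P[].
have U_low : supp2 (fun i j => j <= i + 0)%N U.
  by apply: supp2_sub inverse_lower => i j; rewrite addn0.
have e : diag Q * diag (T * U) = diag T.
  rewrite !diagE -{2}[0%N]addn0 (top_faceM T_low U_low) mulrCA -(top_faceM Q_low U_low) QU.
  rewrite [X in _ * X](_ : _ = 1) ?mulr1 //.
  by apply: fps_ext => i; rewrite [LHS]coef_bfps1 coef_fps1 !addn0 andbb.
have qn k : diag Q k.+2 = 0.
  by apply: contrapT => /eqP /Q_box /and3P[].
have tn k : diag T k.+2 = 0.
  by apply: contrapT => /eqP /Tb /and3P[].
move: (diag (T * U)) e => s e.
have := tn n; rewrite -e coef_fpsM 2!big_ord_recl big1; last first.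
  by move=> i _; rewrite [diag Q _]qn mul0r.
rewrite addr0 subn0 /= /bump /= subSS subn0 => e0.
have -> : s n.+2 = c * (Q 0%N 0%N * s n.+2) by rewrite mulrA [c * _]mulrC Q00 mul1r.
by apply/eqP; rewrite /mu mulNr -mulrA -addr_eq0 -mulrDr e0 mulr0.
Qed.

Variables (p : nat) (digits : seq R).
Hypothesis digitsP : digits_mod p digits.
Hypothesis p_prime : prime p.
Hypothesis R_lift : frob_lift p (@idfun R).

(** A section of the diagonal of T/Q has ratio mu^p from index 1 on, as indices advance by [p]; so
    does the multiple of [p], since mu^p = mu modulo p. Two coefficients, with p^2 values each,
    determine the state, where [state_enum] with [diag_pos] would give p^5. *)
Lemma rational_enum : (p ^ 2)%:R = 0 :> R ->
  exists L : seq (fps R), size L = (p ^ 4)%N /\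
    forall r T g, (r < p)%N -> supp2 (tbox 0) T -> level p 1 0 U 0 0 1 0 g ->
      diag (sect2 p r (T * U) + g *+ p) \in L.
Proof.
move=> p2; have [sz_d dP] := digitsP.
pose rep (x : R * R) : fps R :=
  Fps (fun n => if n is k.+1 then (mu ^+ p) ^+ k * x.2 else x.1).
pose Rs := [seq a + b *+ p | a <- digits, b <- digits].
have RsP (a : R) : a \in Rs.
  have [a0 [a' [a0d ->]]] := dP a; have [a1 [a'' [a1d ->]]] := dP a'.
  apply/allpairsP; exists (a0, a1); split=> //=; rewrite mulrnDl -mulrnA.
  by rewrite -[a'' *+ _]mulr_natr p2 mulr0 addr0.
exists [seq rep (a, b) | a <- Rs, b <- Rs]; split.
  by rewrite !size_allpairs !sz_d; lia.
move=> r T g lt_rp Tb [T1 [g' [T1b _ gE]]]; set f := diag _.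
suff fE : forall n, f n.+2 = mu ^+ p * f n.+1.
  move: (f) fE => s sE; apply/allpairsP; exists (s 0%N, s 1%N); split; rewrite ?RsP //.
  apply: fps_ext; case=> // n /=; elim: n => [|n IHn]; first by rewrite expr0 mul1r.
  by rewrite sE IHn exprS mulrA.
move=> n; have iterE k m : diag (T * U) (m.+1 + k)%N = mu ^+ k * diag (T * U) m.+1.
  elim: k => [|k IHk]; first by rewrite addn0 expr0 mul1r.
  by rewrite addnS addSn (diag_recurrence _ Tb) -addSn IHk exprS mulrA.
have muE : exists e, mu ^+ p = mu + e *+ p by exact: R_lift.
have p_gt0 := prime_gt0 p_prime.
have gE2 : diag (g *+ p) n.+2 = mu ^+ p * diag (g *+ p) n.+1.
  have -> : g *+ p = T1 * U *+ p.
    rewrite gE expr1 mulrnDl -mulrnA (_ : g' *+ _ = 0) ?addr0 //.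
    by apply: bfps_ext => i j; rewrite coef_bfpsMn -mulr_natr p2 mulr0.
  rewrite diagMn !coef_fpsMn (diag_recurrence _ T1b); have [e ->] := muE.
  rewrite mulrDl mulrnAr [X in _ = _ + X](_ : _ = 0) ?addr0 //.
  by rewrite mulrnAl mulrnAr -mulrnA -mulr_natr p2 mulr0.
have fE k : f k = diag (T * U) (p * k + r)%N + diag (g *+ p) k.
  by rewrite /f diagD diag_sect2.
rewrite !fE gE2 mulrDr; congr (_ + _).
have -> : (p * n.+2 + r = (p * n.+1 + r).-1.+1 + p)%N by rewrite prednK; lia.
by rewrite iterE prednK //; lia.
Qed.
End BidegreeOne.

(** * Reduction of p-adic integers *)

Section ZpPower.
Variables (p n : nat).
Hypothesis p_prime : prime p.
Local Notation R := 'Z_(p ^ n.+1).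

Lemma pow_gt1 : (1 < p ^ n.+1)%N.
Proof. by rewrite -[1%N](exp1n n.+1) ltn_exp2r // prime_gt1. Qed.

Lemma Zp_frob_lift : frob_lift p (@idfun R).
Proof.
move=> c; have p_gt0 := prime_gt0 p_prime.
have le_c : (c <= c ^ p)%N.
  have [->//|c_gt0] := posnP c.
  by rewrite -{1}[c : nat]expn1 leq_pexp2l.
exists ((c ^ p - c) %/ p)%N%:R; rewrite -[_ *+ p]mulr_natr -natrM divnK; last first.
  by rewrite -eqn_mod_dvd //; apply/eqP/fermat_little.
by rewrite -[c in LHS]natr_Zp -natrX -[c in X in _ = X + _]natr_Zp -natrD subnKC.
Qed.

Lemma Zp_digits : digits_mod p [seq i%:R : R | i <- iota 0 p].
Proof.
split=> [|c]; first by rewrite size_map size_iota.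
exists (c %% p)%N%:R, (c %/ p)%N%:R; split.
  by rewrite map_f // mem_iota ltn_mod prime_gt0.
by rewrite -[_ *+ p]mulr_natr -natrM -natrD addnC -divn_eq natr_Zp.
Qed.

Lemma Zp_pow0 : (p ^ n.+1)%:R = 0 :> R.
Proof. exact: pchar_Zp pow_gt1. Qed.

Fact padic_mod_zmod : zmod_morphism (@padic_mod p n.+1).
Proof. by move=> x y; rewrite !padic_modS. Qed.

Fact padic_mod_monoid : monoid_morphism (@padic_mod p n.+1).
Proof. by split=> [|x y]; rewrite !padic_modS. Qed.

Lemma padic_mod1E (x : padic p) : padic_mod 1 x = (padic_mod n.+1 x %% p)%N :> nat.
Proof.
have p1 j : (1 < p ^ j.+1)%N by rewrite -[1%N](exp1n j.+1) ltn_exp2r // prime_gt1.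
rewrite !padic_modS; elim: n => [|k IHk].
  rewrite modn_small //; have := ltn_ord (x 0%N).
  by rewrite [X in (_ < X)%N -> _](Zp_cast (p1 0%N)).
rewrite IHk -(padicP x k) val_Zp_nat ?p1 // modn_dvdm //.
by rewrite expnS dvdn_mulr.
Qed.

Lemma padic_mod1_eq0 (x : padic p) : padic_mod 1 x = 0 ->
  exists e, padic_mod n.+1 x = e *+ p.
Proof.
move/(congr1 (@nat_of_ord _)); rewrite padic_mod1E => x0.
exists (padic_mod n.+1 x %/ p)%N%:R; rewrite -[_ *+ p]mulr_natr -natrM divnK ?natr_Zp //.
exact/eqP.
Qed.

Lemma padic_mod1_neq0 (x : padic p) : padic_mod 1 x != 0 ->
  exists c, padic_mod n.+1 x * c = 1.
Proof.
move=> x0; have {}x0 : (padic_mod n.+1 x %% p != 0)%N.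
  by rewrite -padic_mod1E; apply: contra x0 => /eqP e; apply/eqP/val_inj.
exists (padic_mod n.+1 x)^-1; apply: mulrV.
rewrite -[padic_mod _ _]natr_Zp unitZpE ?pow_gt1 // coprimeXl //.
by rewrite prime_coprime.
Qed.

Lemma padic_mod1_neq0S (x : padic p) : padic_mod 1 x != 0 -> padic_mod n.+1 x != 0.
Proof.
move/padic_mod1_neq0 => [c xc]; apply: contra_eq_neq xc => ->.
by rewrite mul0r eq_sym oner_neq0.
Qed.
End ZpPower.

HB.instance Definition _ p n := GRing.isZmodMorphism.Build _ _
  (@padic_mod p n.+1) (@padic_mod_zmod p n).
HB.instance Definition _ p n := GRing.isMonoidMorphism.Build _ _
  (@padic_mod p n.+1) (@padic_mod_monoid p n).

Section MapFps.
Variables (A B : comNzRingType) (phi : {rmorphism A -> B}).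

Definition fps_map (f : fps A) : fps B := Fps (fun n => phi (f n)).

Fact fps_map_zmod : zmod_morphism fps_map.
Proof. by move=> f g; apply: fps_ext => n; rewrite /= rmorphB. Qed.

Fact fps_map_monoid : monoid_morphism fps_map.
Proof.
split=> [|f g]; apply: fps_ext => n.
  by rewrite coef_fps1 -[LHS]/(phi ((1 : fps A) n)) coef_fps1 rmorph_nat.
rewrite coef_fpsM -[LHS]/(phi ((f * g) n)) coef_fpsM rmorph_sum.
by apply: eq_bigr => i _; rewrite rmorphM.
Qed.

HB.instance Definition _ := GRing.isZmodMorphism.Build _ _ fps_map fps_map_zmod.
HB.instance Definition _ := GRing.isMonoidMorphism.Build _ _ fps_map fps_map_monoid.
End MapFps.

Section Degrees.
Variable A : nzRingType.
Implicit Type S : {poly {poly A}}.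

Lemma coef_deg S i j : S`_j`_i != 0 -> (i <= degx S)%N /\ (j <= degy S)%N.
Proof.
move=> Sji; have Sj : S`_j != 0 by apply: contraNneq Sji => ->; rewrite coef0.
have lt_j : (j < size S)%N by rewrite ltnNge; apply: contra Sj => le; rewrite nth_default.
have lt_i : (i < size (S`_j)%R)%N.
  by rewrite ltnNge; apply: contra Sji => le; rewrite nth_default.
have := leq_trans lt_i (max_size_coefXY S j); rewrite /degx /degy.
by case: (sizeY S) => // k; case: (size S) lt_j => // l; rewrite !ltnS.
Qed.

Lemma degx_coef S : S != 0 -> exists j, S`_j`_(degx S) != 0.
Proof.
move=> S0; have := sizeY_eq0 S; rewrite (negPf S0) => /negbT sizeY_n0.
have [|j sizeE] := @bigop.eq_bigmax 'I_(size S) (fun j => size S`_j).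
  by rewrite card_ord size_poly_gt0.
rewrite -/(sizeY S) in sizeE.
exists j; rewrite /degx sizeE -lead_coefE lead_coef_eq0.
by apply: contraNneq sizeY_n0 => Sj; rewrite sizeE Sj size_poly0.
Qed.

Lemma degy_coef S : S != 0 -> exists i, S`_(degy S)`_i != 0.
Proof.
move=> S0; exists (size (lead_coef S)).-1.
by rewrite /degy -lead_coefE -lead_coefE lead_coef_eq0 lead_coef_eq0.
Qed.
End Degrees.

(** * Proof of the bound *)

Lemma supp2_divMn_exists (R : comNzRingType) p (b : nat -> nat -> bool) (f : fps (fps R)) :
  supp2 b f -> (forall i j, exists e, f j i = e *+ p) ->
  exists E, supp2 b E /\ f = E *+ p.
Proof.
move=> fb fp.
have /choice[e eP] (ij : nat * nat) : exists e, f ij.2 ij.1 = e *+ p by apply: fp.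
pose E : fps (fps R) := Fps (fun j => Fps (fun i => e (i, j))).
exists (restrict2 b E); split; first exact: supp2_restrict.
by apply: supp2_divMn => //; apply: bfps_ext => i j; rewrite coef_bfpsMn (eP (i, j)).
Qed.

Section Reduction.
Variables (p n : nat) (P : {poly {poly (padic p)}}) (F : fps (padic p)).
Hypothesis p_prime : prime p.
Hypothesis FP : furstenberg P F.
Local Notation R := 'Z_(p ^ n.+1).
Local Notation P1 := (poly_mod 1 P).
Local Notation S := (poly_mod n.+1 P).
Let h := degx P1.
Let d := degy P1.
Let ex := (degx S - h)%N.
Let ey := (degy S - d)%N.

Lemma coef_poly_mod k i j : (poly_mod k.+1 P)`_j`_i = padic_mod k.+1 P`_j`_i.
Proof. by rewrite /poly_mod !coef_map_id0 ?map_poly0 ?rmorph0. Qed.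

Lemma coef_mod_low i j : ~~ ((i <= h)%N && (j <= d)%N) -> exists e, S`_j`_i = e *+ p.
Proof.
move=> low; rewrite coef_poly_mod; apply: padic_mod1_eq0 => //; rewrite -coef_poly_mod.
by apply: contraNeq low => /coef_deg[-> ->].
Qed.

Lemma mod1_P00 : P1`_0`_0 = 0.
Proof. by case: FP => P0 _ _ _; rewrite coef_poly_mod -!horner_coef0 P0 rmorph0. Qed.

Lemma mod1_P10 : P1`_1`_0 != 0.
Proof.
case: FP => _ P10 _ _; rewrite coef_poly_mod.
by move: P10; rewrite !horner_coef0 coef_deriv mulr1n.
Qed.

Lemma degy_gt0 : (0 < d)%N.
Proof. by case: (coef_deg mod1_P10). Qed.

Lemma mod_P00 : S`_0`_0 = 0.
Proof. by case: FP => P0 _ _ _; rewrite coef_poly_mod -!horner_coef0 P0 rmorph0. Qed.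

Lemma mod_P10 : exists c, S`_1`_0 * c = 1.
Proof.
rewrite coef_poly_mod; apply: padic_mod1_neq0 => //.
by rewrite -coef_poly_mod mod1_P10.
Qed.

Lemma degy_le : (d <= degy S)%N.
Proof.
have P1n0 : P1 != 0 by apply: contraNneq mod1_P10 => ->; rewrite !coef0.
have [i] := degy_coef P1n0; rewrite coef_poly_mod => /(padic_mod1_neq0S n p_prime).
by rewrite -coef_poly_mod => /coef_deg[].
Qed.

Local Notation phi := (fps_map (@padic_mod p n.+1)).

Lemma mod_root : (map_poly (@fps_of_poly R) S).[phi F] = 0.
Proof.
case: FP => _ _ _ /(congr1 phi); rewrite rmorph0 => <-; rewrite -horner_map.
congr (_.[_]); apply/polyP => j; rewrite coef_map; apply: fps_ext => i.
rewrite coef_fps_map coef_poly_mod.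
by rewrite -[RHS]/(padic_mod n.+1 ((map_poly (@fps_of_poly (padic p)) P)`_j i)) coef_fps_map.
Qed.

Lemma coef_deg_ex i j : S`_j`_i != 0 -> (i <= h + ex)%N /\ (j <= d + ey)%N.
Proof.
case/coef_deg => i_le j_le.
by split; [apply: leq_trans i_le _|apply: leq_trans j_le _]; rewrite -leq_subLR.
Qed.

Local Notation G := (shear_den S).
Local Notation A := (shear_num S d).
Definition trunc_den := restrict2 (box h 1 d.-1) G.
Definition trunc_num := restrict2 (box h 0 d.-1) A.

Lemma trunc_den_box : supp2 (box h 1 d.-1) trunc_den. Proof. exact: supp2_restrict. Qed.
Lemma trunc_num_box : supp2 (box h 0 d.-1) trunc_num. Proof. exact: supp2_restrict. Qed.

Lemma trunc_den_decomp : exists E,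
  supp2 (box (h + ex) 1 (d.-1 + ey)) E /\ G = trunc_den + E *+ p.
Proof.
have d_gt0 := degy_gt0.
have [||E [Eb GE]] := @supp2_divMn_exists _ p (box (h + ex) 1 (d.-1 + ey)) (G - trunc_den).
- apply: supp2B; last by apply: box_le trunc_den_box; rewrite ?leq_addr.
  move=> i j /=; case: ifP => [le_i /coef_deg_ex[]|]; last by rewrite eqxx.
  by rewrite /box; lia.
- move=> i j; rewrite -[(G - trunc_den) j i]/(G j i - trunc_den j i) /trunc_den /=.
  case: (boolP (box _ _ _ _ _)) => [_|nb]; first by exists 0; rewrite subrr mul0rn.
  rewrite subr0; case: ifP => [le_i|]; last by exists 0; rewrite mul0rn.
  by apply: coef_mod_low; move: nb; rewrite /box; lia.
by exists E; split=> //; rewrite -GE addrC subrK.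
Qed.

Lemma trunc_num_decomp : exists E,
  supp2 (box (h + ex) 0 (d.-1 + ey).+1) E /\ A = trunc_num + E *+ p.
Proof.
have d_gt0 := degy_gt0.
have [||E [Eb GE]] := @supp2_divMn_exists _ p (box (h + ex) 0 (d.-1 + ey).+1) (A - trunc_num).
- apply: supp2B; last by apply: box_le trunc_num_box; rewrite ?leq_addr //; lia.
  move=> i j /=; case: ifP => [le_i|]; last by rewrite eqxx.
  have [->|/coef_deg_ex[]] := eqVneq (S`_(j - i)`_i) 0; first by rewrite !mul0rn subrr eqxx.
  by rewrite /box; lia.
- move=> i j; rewrite -[(A - trunc_num) j i]/(A j i - trunc_num j i) /trunc_num /=.
  case: (boolP (box _ _ _ _ _)) => [_|nb]; first by exists 0; rewrite subrr mul0rn.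
  rewrite subr0; case: ifP => [le_i|]; last by exists 0; rewrite mul0rn.
  (* On the row y^d the factor (j - i) - d vanishes: this is the effect of subtracting d P. *)
  have [->|ne_d] := eqVneq (j - i)%N d; first by exists 0; rewrite subrr mul0rn.
  have [|e ->] := @coef_mod_low i (j - i); first by move: nb; rewrite /box; lia.
  by exists (e *+ (j - i) - e *+ d); rewrite mulrnBl -!mulrnA ![(p * _)%N]mulnC.
by exists E; split=> //; rewrite -GE addrC subrK.
Qed.

Lemma trunc_den00 : exists c, trunc_den 0%N 0%N * c = 1.
Proof. by have [c cP] := mod_P10; exists c. Qed.

Lemma shear_den_inv : exists V, G * V = 1.
Proof. by have [c cP] := mod_P10; apply: (bfps_inv_exists (a := c)). Qed.

Lemma trunc_den_inv : exists U, trunc_den * U = 1.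
Proof. by have [c cP] := trunc_den00; apply: bfps_inv_exists cP. Qed.

Lemma mod_diag V : G * V = 1 -> diag (A * V) = phi F.
Proof.
move=> GV; have [c cP] := mod_P10; apply: (furstenberg_formula mod_P00 cP) mod_root _ _ GV.
by case: FP => _ _ F0 _; rewrite /= F0 rmorph0.
Qed.

(** All positions are counted unless h = d = 1; then diagonal positions are used for alpha >= 3 and
    the recurrence for alpha = 2. *)
Lemma kernel_prime_power a u : n = a.+1 -> (0 < h)%N ->
  (0 < u)%N -> (n.+1 * ex < p ^ u)%N -> ((n.+1 * ey).+1 < p ^ u)%N ->
  exists L : seq (fps R), (size L <= p ^ expN n.+1 h d)%N /\
    forall w : seq 'I_p, (u <= size w)%N -> sect1w (phi F) w \in L.
Proof.
move=> n_a h_gt0 u_gt0 ex_u ey_u; have d_gt0 := degy_gt0.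
have p_gt0 := prime_gt0 p_prime.
have [V GV] := shear_den_inv; have [U QU] := trunc_den_inv.
have [E [Eb GE]] := trunc_den_decomp; have [A1 [A1b AE]] := trunc_num_decomp.
have st := state_init trunc_den_box QU Eb GE GV n trunc_num_box A1b AE.
rewrite -(mod_diag GV).
have [hd1|hd1] := boolP ((h != 1%N) || (d != 1%N)).
  have [|m T Tb|L [sz_L LP]] := state_kernel (@Zp_digits p n p_prime) p_prime
    (@Zp_frob_lift p n p_prime) trunc_den_box QU (pos := tbox_pos h d.-1) _ _
    (@Zp_pow0 p n p_prime) st u_gt0 ex_u ey_u.
  - by move=> m i j; rewrite mem_tbox_pos.
  - by exists T => //; apply: supp2_sub Tb => i j; rewrite mem_tbox_pos.
  exists L; split=> //; rewrite sz_L leq_pexp2l //.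
  by apply: state_count_le; rewrite // n_a.
have [h1 d1] : h = 1%N /\ d = 1%N by move: hd1; lia.
have [c Q00] := trunc_den00; have Qb := trunc_den_box; rewrite h1 d1 /= in st Qb *.
have R_lift := @Zp_frob_lift p n p_prime; have digitsP := @Zp_digits p n p_prime.
have [a0|a_gt0] := posnP a.
  have p2 : (p ^ 2)%:R = 0 :> R by rewrite -(@Zp_pow0 p n p_prime) n_a a0.
  have [L [sz_L LP]] := rational_enum Qb QU Q00 digitsP p_prime R_lift p2.
  exists L; split=> [|w le_u]; first by rewrite sz_L n_a a0 leq_pexp2l.
  rewrite -diag_sect2w.
  have [r [T [g [Tb gl ->]]]] := state_late p_prime R_lift Qb QU st u_gt0 ex_u ey_u le_u.
  have glE k : n = k -> level p 1 0 U 0 0 k 0 g by move=> <-.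
  by apply: LP => //; apply: glE; rewrite n_a a0.
have [|m T Tb|L [sz_L LP]] := state_kernel digitsP p_prime R_lift Qb QU (pos := diag_pos) _ _
    (@Zp_pow0 p n p_prime) st u_gt0 ex_u ey_u.
- exact: diag_pos_box.
- exact: (diag_pos_diag Qb QU Q00).
exists L; split=> //; rewrite sz_L leq_pexp2l //.
by rewrite n_a diag_count_le.
Qed.
End Reduction.

Section LaurentDegree.
Variables (A : nzRingType) (S : {poly {poly A}}) (Q : laurent2 A).
Hypothesis QS : forall m, Q m = div_y S m.

(** A nonzero coefficient in the column rules out the conventional value of [ldeg], so the degree is
    attained by a monomial. *)
Lemma ldeg_proj_x (i j : nat) : S`_j`_i != 0 ->
  exists k : nat, S`_k`_i != 0 /\ ldeg (proj_x i%:Z Q) = k%:Z - 1.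
Proof.
move=> Sji; have : ldeg (proj_x i%:Z Q) \in finsupp (proj_x i%:Z Q).
  apply: ldeg_in; apply/fset0Pn; exists (j%:Z - 1).
  by rewrite mem_finsupp proj_xE QS div_yE.
rewrite mem_finsupp proj_xE QS; set b := ldeg _ => Sb.
have b_ge : -1 <= b.
  by rewrite leNgt; apply: contra Sb => lt_b; rewrite div_y0 //; right.
have bE : b = (absz (b + 1))%:Z - 1 by lia.
by exists (absz (b + 1)); split; rewrite // -div_yE -bE.
Qed.

Lemma ldeg_proj_y (i j : nat) : S`_j`_i != 0 ->
  exists k : nat, S`_j`_k != 0 /\ ldeg (proj_y (j%:Z - 1) Q) = k%:Z.
Proof.
move=> Sji; have : ldeg (proj_y (j%:Z - 1) Q) \in finsupp (proj_y (j%:Z - 1) Q).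
  apply: ldeg_in; apply/fset0Pn; exists i%:Z.
  by rewrite mem_finsupp proj_yE QS div_yE.
rewrite mem_finsupp proj_yE QS; set b := ldeg _ => Sb.
have b_ge : 0 <= b.
  by rewrite leNgt; apply: contra Sb => lt_b; rewrite div_y0 //; left.
have bE : b = (absz b)%:Z by lia.
by exists (absz b); split; rewrite // -div_yE -bE.
Qed.
End LaurentDegree.

Lemma kernel_prime p (P : {poly {poly (padic p)}}) (F : fps (padic p))
    (Q : laurent2 'Z_(p ^ 1)) m :
  prime p -> furstenberg P F ->
  let h := degx (poly_mod 1 P) in let d := degy (poly_mod 1 P) in
  (0 < h)%N -> (forall k, Q k = div_y (poly_mod 1 P) k) ->
  (h < p ^ m)%N -> (d < p ^ m)%N ->
  d%:Z - 1 - ldeg (proj_x 0 Q) < (p ^ m)%N%:Z ->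
  d%:Z - 1 - ldeg (proj_x h%:Z Q) < (p ^ m)%N%:Z ->
  h%:Z - ldeg (proj_y (d%:Z - 1) Q) < (p ^ m)%N%:Z ->
  exists L : seq (fps 'Z_(p ^ 1)),
    (size L <= p ^ (h * d) + m + p ^ (h.-1 * d.-1) * landau3 h d d)%N /\
    forall w : seq 'I_p, sect1w (fps_map (@padic_mod p 1) F) w \in L.
Proof.
move=> p_prime FP h d h_gt0 QP h_m d_m l_m r_m t_m.
have d_gt0 : (0 < d)%N := degy_gt0 FP.
set S := poly_mod 1 P in h d h_gt0 QP h_m d_m l_m r_m t_m d_gt0 *.
have S_n0 : S != 0 by apply: contraNneq (mod1_P10 FP) => S0; rewrite -/S S0 !coef0.
have [V GV] := shear_den_inv 0 p_prime FP; have [U QU] := trunc_den_inv 0 p_prime FP.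
have R_char : p%:R = 0 :> 'Z_(p ^ 1) by have := @Zp_pow0 p 0 p_prime; rewrite expn1.
have mulp0 (f : fps (fps 'Z_(p ^ 1))) : f *+ p = 0.
  by apply: bfps_ext => i j; rewrite coef_bfpsMn -mulr_natr R_char mulr0.
have GE : shear_den S = trunc_den 0 P.
  by have [E [_ ->]] := trunc_den_decomp 0 p_prime FP; rewrite mulp0 addr0.
have AE : shear_num S d = trunc_num 0 P.
  by have [E [_ ->]] := trunc_num_decomp 0 p_prime FP; rewrite mulp0 addr0.
have VU : V = U by rewrite -[V]mulr1 -QU -GE mulrA [V * _]mulrC GV mul1r.
have Q_coef i j : box h 1 d.-1 i j -> trunc_den 0 P j i = S`_(j.+1 - i)`_i.
  by move=> ij; rewrite -GE /=; case: leqP => // lt_ji; case/and3P: ij; lia.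
have Qb : supp2 (box h 1 d.-1) (trunc_den 0 P) by exact: trunc_den_box.
have Ab : supp2 (box h 0 d.-1) (trunc_num 0 P) by exact: trunc_num_box.
have [dl [Sl ldegl]] := ldeg_proj_x QP (mod1_P10 FP).
have [jr /(ldeg_proj_x QP)[dr [Sr ldegr]]] := degx_coef S_n0.
have [it /(ldeg_proj_y QP)[dt [St ldegt]]] := degy_coef S_n0.
rewrite -/h -/d in Sr ldegr St ldegt.
(* P(0, 0) = 0 keeps y^(-1) out of the column x^0 of P/y. *)
have dl_gt0 : (0 < dl)%N.
  by rewrite lt0n; apply: contraNneq Sl => ->; rewrite (mod1_P00 FP).
have [_ dl_d] := coef_deg Sl; have [_ dr_d] := coef_deg Sr; have [dt_h _] := coef_deg St.
rewrite -/h -/d in dl_d dr_d dt_h.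
rewrite ldegl in l_m; rewrite ldegr in r_m; rewrite ldegt in t_m.
have [l [l_gt0 l_le l_per]] : exists l, [/\ (0 < l)%N, (l <= landau3 h d.-1.+1 d.-1.+1)%N
    & forall e, (m <= e)%N -> supp2 (inner_supp h d.-1)
        (orbit_num p (trunc_den 0 P) (trunc_num 0 P) (e + l) -
         orbit_num p (trunc_den 0 P) (trunc_num 0 P) e)].
  (* The leading monomials y^(dl-1) and x^h y^(dr-1) of the columns have Y-exponents dl - 1 and dr +
     h - 1. *)
  apply: (orbit_num_periodic (dl := dl.-1) (dr := (dr + h).-1) (dt := dt) p_prime
    Qb h_gt0 (border_periodic_Zp p_prime) Ab) => //.
  - rewrite Q_coef; last by rewrite /box; lia.
    by rewrite subn0 prednK.
  - rewrite Q_coef; last by rewrite /box; lia.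
    by rewrite prednK ?addnK // addn_gt0 h_gt0 orbT.
  - rewrite Q_coef; last by rewrite /box; lia.
    by rewrite -addnS addKn prednK.
  - by lia.
  - by lia.
  - by lia.
  - by rewrite prednK.
rewrite prednK // in l_le.
have [L [sz_L LP]] := orbit_kernel (@Zp_digits p 0 p_prime) p_prime
  (@Zp_frob_lift p 0 p_prime) R_char Qb QU h_gt0 Ab l_gt0 l_per.
exists L; split=> [|w]; first by rewrite sz_L prednK // leq_add2l leq_mul2l l_le orbT.
by rewrite -(mod_diag p_prime FP GV) AE VU; apply: LP.
Qed.

Lemma lt_exp_floor_log p z k : (1 < p)%N -> 0 <= z -> ((floor_log p z).+1 <= k)%N ->
  z < (p ^ k)%N%:Z.
Proof.
move=> p_gt1 z_ge0 le_k; have := trunc_log_ltn (absz z) p_gt1.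
rewrite -/(floor_log p z) => lt_z.
have := leq_trans lt_z (leq_pexp2l (ltnW p_gt1) le_k).
by rewrite -(ltr_nat int) !natz gez0_abs.
Qed.

Theorem theorem2 (p : nat) (p_prime : prime p)
    (alpha : nat) (alpha_gt0 : (0 < alpha)%N)
    (P : {poly {poly (padic p)}}) (F : fps (padic p))
    (FP : furstenberg P F)
    (Q : laurent2 'Z_(p ^ alpha)) :
  let h := degx (poly_mod 1 P) in
  let d := degy (poly_mod 1 P) in
  (1 <= h)%N ->
  same_support_lift Q (div_y (poly_mod 1 P)) ->
  let N := expN alpha h d in
  let u := (floor_log p
    (Num.max (alpha%:Z * ((degx (poly_mod alpha P))%:Z - h%:Z))
             (alpha%:Z * ((degy (poly_mod alpha P))%:Z - d%:Z) + 1))).+1 in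
  let ul := (floor_log p
    (Num.max ((p ^ (alpha - 1))%N%:Z *
                (d%:Z - 1 - ldeg (proj_x 0 Q))) 1)).+1 in
  let ur := (floor_log p
    (Num.max ((p ^ (alpha - 1))%N%:Z *
                (d%:Z - 1 - ldeg (proj_x h%:Z Q))) 1)).+1 in
  let ut := (floor_log p
    (Num.max ((p ^ (alpha - 1))%N%:Z *
                (h%:Z - ldeg (proj_y (d%:Z - 1) Q))) 1)).+1 in
  exists M : dfao p 'Z_(p ^ alpha),
    minimal_dfao M (fun n => padic_mod alpha (F n)) /\
    (dfao_size M <=
       p ^ N
       + p ^ (N - (alpha * alpha.+1 * (h + d - 1)) %/ 2) * landau3 h d d
       + maxn (maxn ul ur) ut
       + floor_log p (maxn h d)
       + (2 * alpha - 1)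
       + (p ^ u - 1) %/ (p - 1))%N.
Proof.
move=> h d h_gt0 Q_lift N u ul ur ut; have p_gt1 := prime_gt1 p_prime.
have d_gt0 : (0 < d)%N := degy_gt0 FP.
have p1_gt0 : (0 < p - 1)%N by rewrite subn_gt0.
have uE : ((p ^ u - 1) %/ (p - 1) = \sum_(i < u) p ^ i)%N.
  by rewrite !subn1 predn_exp mulKn // -subn1.
case: alpha alpha_gt0 => [//|[|n]] _ in Q Q_lift N u ul ur ut uE *.
  (* Number of zeros after which all faces are periodic; the summand 2 alpha - 1 = 1 accounts for
     the successor. *)
  pose m := (maxn (maxn ul ur) ut + (floor_log p (maxn h d)).+1)%N.
  have QP k : Q k = div_y (poly_mod 1 P) k.
    by rewrite -(proj1 Q_lift); apply/esym/natr_Zp.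
  have hd_m : (maxn h d < p ^ m)%N.
    rewrite -ltz_nat; apply: lt_exp_floor_log => //.
    by rewrite leq_addl.
  have le_m (z : int) k : (floor_log p (Num.max ((p ^ (1 - 1))%N%:Z * z) 1)%R < k)%N ->
      (k <= m)%N -> z < (p ^ m)%N%:Z.
    move=> z_k k_m; apply: le_lt_trans (lt_exp_floor_log p_gt1 _ (leq_trans z_k k_m)).
      by rewrite mul1r le_max lexx.
    by rewrite le_max ler01 orbT.
  have [|||||L [sz_L LP]] := kernel_prime (m := m) p_prime FP h_gt0 QP.
  - by apply: leq_ltn_trans hd_m; apply: leq_maxl.
  - by apply: leq_ltn_trans hd_m; apply: leq_maxr.
  - by apply: (le_m _ ul) => //; rewrite /m; lia.
  - by apply: (le_m _ ur) => //; rewrite /m; lia.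
  - by apply: (le_m _ ut) => //; rewrite /m; lia.
  have [M [M_min M_size]] := minimal_dfao_of_kernel p_gt1 LP.
  exists M; split=> //; apply: leq_trans M_size (leq_trans sz_L _).
  have NE : N = (h * d)%N.
    have := expNE 1 h_gt0 d_gt0; rewrite -/N -[(2 * h * d)%N]mulnA.
    by have : (0 < h * d)%N; [rewrite muln_gt0 h_gt0|move: (h * d)%N => c; lia].
  (* This exponent is the number of inner positions. *)
  have -> : (N - (1 * 2 * (h + d - 1)) %/ 2 = h.-1 * d.-1)%N.
    rewrite NE mul1n mulKn //; case: (h) h_gt0 => // h' _; case: (d) d_gt0 => // d' _.
    by rewrite /= mulSn mulnS; lia.
  have u1 : (1 <= \sum_(i < u) p ^ i)%N by rewrite big_ord_recl expn0.
  rewrite uE NE /m; move: (p ^ (h * d))%N (p ^ _ * _)%N u1; lia.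
(* Now alpha = n + 2: words shorter than u are counted by the tree, all others lead to at most p^N
   series. *)
have ey_ge := degy_le n.+1 p_prime FP.
set z := Num.max _ _ in u uE *.
have z_y : ((n.+2 * (degy (poly_mod n.+2 P) - d)).+1)%:Z <= z.
  rewrite le_max; apply/orP; right.
  by rewrite subzn // -PoszM -addn1 PoszD.
have z_x : (n.+2 * (degx (poly_mod n.+2 P) - h))%:Z <= z.
  have [le_x|/ltnW lt_x] := leqP h (degx (poly_mod n.+2 P)).
    by rewrite le_max; apply/orP; left; rewrite subzn // -PoszM.
  by apply: le_trans z_y; move: lt_x; rewrite -subn_eq0 => /eqP ->; rewrite muln0.
have z_u : z < (p ^ u)%N%:Z by apply: lt_exp_floor_log => //; apply: le_trans z_y.
have [|||L [sz_L LP]] := @kernel_prime_power p n.+1 P F p_prime FP n u erefl h_gt0.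
- by [].
- by rewrite -ltz_nat; apply: le_lt_trans z_u.
- by rewrite -ltz_nat; apply: le_lt_trans z_u.
have [T [sz_T TP]] := @kernel_tree _ p (fps_map (@padic_mod p n.+2) F) u.
have [w|M [M_min M_size]] := @minimal_dfao_of_kernel _ p
    (fps_map (@padic_mod p n.+2) F) (T ++ L) p_gt1.
  by rewrite mem_cat; case: (ltnP (size w) u) => [/TP ->|/LP ->] //; rewrite orbT.
exists M; split=> //; apply: leq_trans M_size _.
rewrite size_cat sz_T uE; apply: leq_trans (leq_add (leqnn _) sz_L) _.
by rewrite addnC leq_add2r -/N -!addnA leq_addr.
Qed.
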